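(* The structures $\mathfrak B_1$ and $\mathfrak C_1$ are mutually definable (each is definable in terms of the other). Consequently, the affine space $\mathfrak A$, and thus the projective space $\mathfrak P$, is definable in terms of $\mathfrak C_1$.
   Context: Setting. $\mathfrak F$ is a perfect field of characteristic $2$, $\mathbb V$ is a vector space over $\mathfrak F$ of finite dimension $n\ge 2$, and $\mathfrak P$ is the projective space of $\mathbb V$ (points are $\langle u\rangle$ with $u\in\mathbb V$ nonzero). Lines of $\mathfrak P$ have at least $6$ points. $\xi$ is a nondegenerate symmetric bilinear form on $\mathbb V$ which is not alternating, and $\langle u\rangle\perp\langle v\rangle$ means $\xi(u,v)=0$. The set $\mathbf H$ of selfconjugate points ($p\perp p$) is then a hyperplane of $\mathfrak P$, and its pole is a point $\mathbf b$ (so $\mathbf b^\perp=\mathbf H$); $\mathbf b$ may or may not lie on $\mathbf H$. A subspace $U$ of $\mathfrak P$ is regular if $U\cap U^\perp=\emptyset$, where $U^\perp=\{p: p\perp q\text{ for all }q\in U\}$; regular points are exactly the points not on $\mathbf H$. Structures. $\mathfrak A$ is the affine space obtained from $\mathfrak P$ by deleting $\mathbf H$; its lines are identified with the lines of $\mathfrak P$ not contained in $\mathbf H$. $\mathfrak B_1$ is the point-line structure with points the regular points different from $\mathbf b$, lines the regular lines not contained in $\mathbf H$, and natural incidence. $\mathfrak C_1$ has the same points as $\mathfrak B_1$, and its lines are the regular lines not contained in $\mathbf H$ and not passing through $\mathbf b$, with natural incidence. Definability. Let $M,N$ be structures whose elements are points or subspaces of $\mathfrak P$. $N$ is definable in terms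 of $M$ if it can be described using only the primitive notions of $M$: the elements of $N$ can be represented by tuples of elements of $M$ ranging over sets given by parameter-free first-order formulas in the language of $M$, modulo equivalence relations given by such formulas, in such a way that all the primitive relations of $N$, and the natural inclusion relations between elements of $N$ and elements of $M$ (as subspaces of $\mathfrak P$), are given by such formulas as well. *)

(* Defs.v *)
(* A subspace of the projective space of V is a {vspace V},
   of projective dimension one less than \dim; a point is thus a vector line,
   the empty subspace is 0%VS, and incidence is inclusion of vspaces. *)
From HB Require Import structures.
From mathcomp Require Import all_boot all_order all_algebra sesquilinear.
Set Implicit Arguments.
Unset Strict Implicit.
Unset Printing Implicit Defensive.
Import GRing.Theory.
Local Open Scope ring_scope.

(** * First-order formulas and definability *)

Record signature := Signature { symbol : Type; arity : symbol -> nat }.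

(* [formula S X]: first-order formulas with equality over the relational
   signature S, without parameters, whose free variables are taken in X.  A
   quantifier binds the variable [None]. *)
Inductive formula (S : signature) : Type -> Type :=
| FEq  X : X -> X -> formula S X
| FRel X (s : symbol S) : ('I_(arity s) -> X) -> formula S X
| FNot X : formula S X -> formula S X
| FAnd X : formula S X -> formula S X -> formula S X
| FOr  X : formula S X -> formula S X -> formula S X
| FEx  X : formula S (option X) -> formula S X
| FAll X : formula S (option X) -> formula S X.

Definition bind_var (T X : Type) (x : T) (e : X -> T) (v : option X) : T :=
  if v is Some w then e w else x.

Definition sum_env (T X Y : Type) (e : X -> T) (f : Y -> T) (v : X + Y) : T :=
  match v with inl x => e x | inr y => f y end.

Section Definability.

Variables (F : fieldType) (V : vectType F).

Record structure := Structure {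
  sig : signature;
  elt : {vspace V} -> Prop;
  interp : forall s : symbol sig, ('I_(arity s) -> {vspace V}) -> Prop
}.

(* Quantifiers range over the elements of M only. *)
Fixpoint sat (M : structure) (X : Type) (phi : formula (sig M) X) :
    (X -> {vspace V}) -> Prop :=
  match phi in formula _ Y return (Y -> {vspace V}) -> Prop with
  | FEq _ x y => fun e => e x = e y
  | FRel _ s a => fun e => interp (fun i => e (a i))
  | FNot _ f => fun e => ~ sat f e
  | FAnd _ f g => fun e => sat f e /\ sat g e
  | FOr _ f g => fun e => sat f e \/ sat g e
  | FEx _ f => fun e => exists2 x, elt M x & sat f (bind_var x e)
  | FAll _ f => fun e => forall x, elt M x -> sat f (bind_var x e)
  end.

(* Representation of elements of N by tuples of elements of M.  Different kinds
   of elements of N may be represented by tuples of different lengths: there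
   are finitely many kinds i, the tuples of kind i have length [len i] and range
   over the set defined by [dom i], and [rep i] sends such a tuple to the element
   it represents.  That [equiv i j] defines [rep i t = rep j u] makes these
   formulas define an equivalence relation whose classes correspond bijectively
   to the elements of N. *)
Definition in_dom (M : structure) (k : nat) (dom : formula (sig M) 'I_k)
    (t : 'I_k -> {vspace V}) : Prop :=
  (forall a, elt M (t a)) /\ sat dom t.

Definition definable_in (N M : structure) : Prop :=
  exists (I : finType) (len : I -> nat)
    (dom : forall i, formula (sig M) 'I_(len i))
    (equiv : forall i j, formula (sig M) ('I_(len i) + 'I_(len j)))
    (rep : forall i, ('I_(len i) -> {vspace V}) -> {vspace V}),
  [/\ (forall i t, in_dom (dom i) t -> elt N (rep i t))
      /\ (forall y, elt N y -> exists i t, in_dom (dom i) t /\ rep i t = y),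
      forall i j t u, in_dom (dom i) t -> in_dom (dom j) u ->
        sat (equiv i j) (sum_env t u) <-> rep i t = rep j u,
      (* primitive relations of N, for arguments of the kinds [c] *)
      forall (s : symbol (sig N)) (c : 'I_(arity s) -> I),
        exists phi : formula (sig M) {a : 'I_(arity s) & 'I_(len (c a))},
        forall t : (forall a, 'I_(len (c a)) -> {vspace V}),
          (forall a, in_dom (dom (c a)) (t a)) ->
          sat phi (fun v => t (tag v) (tagged v))
            <-> interp (fun a => rep (c a) (t a)),
      (* inclusion of an element of M in an element of N *)
      forall i, exists phi : formula (sig M) (option 'I_(len i)),
        forall x t, elt M x -> in_dom (dom i) t ->
          sat phi (bind_var x t) <-> (x <= rep i t)%VS
    & (* inclusion of an element of N in an element of M *)
      forall i, exists phi : formula (sig M) (option 'I_(len i)),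
        forall x t, elt M x -> in_dom (dom i) t ->
          sat phi (bind_var x t) <-> (rep i t <= x)%VS].

(** * Point-line structures with natural incidence *)

Inductive point_line_symbol := SPoint | SLine | SInc.

Definition point_line_sig : signature :=
  Signature (fun s => match s with SPoint => 1 | SLine => 1 | SInc => 2 end)%N.

Definition point_line_interp (pt ln : {vspace V} -> Prop)
    (s : symbol point_line_sig) : ('I_(arity s) -> {vspace V}) -> Prop :=
  match s with
  | SPoint => fun e : 'I_1 -> {vspace V} => pt (e ord0)
  | SLine => fun e : 'I_1 -> {vspace V} => ln (e ord0)
  | SInc => fun e : 'I_2 -> {vspace V} =>
      [/\ pt (e ord0), ln (e ord_max) & (e ord0 <= e ord_max)%VS]
  end.

Definition point_line_structure (pt ln : {vspace V} -> Prop) : structure :=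
  @Structure point_line_sig (fun x => pt x \/ ln x) (@point_line_interp pt ln).

End Definability.

(** * Metric-projective geometry *)

Definition perfect_field (F : fieldType) : Prop :=
  forall p : nat, p \in [pchar F] -> forall x : F, exists y : F, x = y ^+ p.

Section Geometry.

Variables (F : fieldType) (V : vectType F).

Definition is_point (p : {vspace V}) : bool := \dim p == 1%N.
Definition is_line (L : {vspace V}) : bool := \dim L == 2%N.

Definition lines_have_at_least (m : nat) : Prop :=
  forall L : {vspace V}, is_line L ->
    exists s : seq {vspace V},
      [/\ uniq s, size s = m & all (fun p => is_point p && (p <= L)%VS) s].

Variable xi : {symmetric V}.

Definition perp (U W : {vspace V}) : bool := (U <= orthov xi W)%VS.

Definition alternating : Prop := forall u : V, xi u u = 0.

Definition on_H (p : {vspace V}) : Prop := is_point p /\ perp p p.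

Definition contained_in_H (U : {vspace V}) : Prop :=
  forall p, is_point p -> (p <= U)%VS -> on_H p.

Definition pole_of_H (b : {vspace V}) : Prop :=
  is_point b /\ forall p, is_point p -> (perp p b <-> on_H p).

Definition regular (U : {vspace V}) : Prop := (U :&: orthov xi U)%VS = 0%VS.

Definition structP : structure V := point_line_structure is_point is_line.

Definition structA : structure V :=
  point_line_structure
    (fun p => is_point p /\ ~ on_H p)
    (fun L => is_line L /\ ~ contained_in_H L).

Definition structB1 (b : {vspace V}) : structure V :=
  point_line_structure
    (fun p => [/\ is_point p, regular p & p <> b])
    (fun L => [/\ is_line L, regular L & ~ contained_in_H L]).

Definition structC1 (b : {vspace V}) : structure V :=
  point_line_structure
    (fun p => [/\ is_point p, regular p & p <> b])
    (fun L => [/\ is_line L, regular L, ~ contained_in_H L & ~ (b <= L)%VS]).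

End Geometry.

(* Main.v *)
From HB Require Import structures.
Require Import Defs.
From mathcomp Require Import all_boot all_order all_algebra sesquilinear.
From mathcomp Require Import ring.
From Stdlib Require Import Classical FunctionalExtensionality.
From Stdlib Require Import ClassicalEpsilon.
Set Implicit Arguments.
Unset Strict Implicit.
Unset Printing Implicit Defensive.
Import GRing.Theory.
Local Open Scope ring_scope.

(** Write <bv> for the pole b.  In characteristic 2 the map u |-> xi u u is
    additive, and as the field is perfect it is the square of a linear form;
    rescaling bv, that form is xi _ bv.  Hence H is the kernel of xi _ bv, and
    the points off H are the vectors of the affine hyperplane xi u bv = 1.  For
    two such vectors the line through u and v is regular exactly when
    xi u v <> 1 ([regular_line]), so all structures in the theorem are read off
    from the function xi on this hyperplane.

    Call two points near if no line of C1 joins them.  The heart of the proof is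
    that collinearity in the affine space is definable from C1
    ([definable_col]); only near pairs are a problem.  Since xi bv bv is 0 or 1,
    there are two cases.

    - If b lies on H, the points near to both of two distinct near points are
      those of a set whose common near points again form exactly the affine line
      of the pair.  This is a double orthogonal complement for nonregular lines,
      and a direct computation for lines through b ([col_of_double_near]).
    - If b is off H, then B1 and C1 coincide and nearness is xi u v = 1.  Two
      points are on a line through b when they have the same near points
      ([pole_line_of_near]).  A nonregular line through u and v that misses b is
      recovered in its plane with an auxiliary point c: pick p and q on the lines
      of C1 joining c to u and v; the points of the line are those near to u that
      a line of C1 through c joins to a point of the line pq of C1
      ([col_of_triangle]).  Six points on a line leave enough scalars to choose
      c, p and q.

    Once collinearity is available, affine geometry takes over: adjoining b as a
    point when it is off H, flats and parallelism are definable
    ([adef_in_flat], [adef_direction_line]).  Every point or line of the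
    projective space is spanned by points of C1, or is the trace on H of the
    span of one more point, or is b itself ([rep_onto]), and inclusion between
    such subspaces reduces to flats and parallelism ([adef_le]).  So any
    point-line structure whose elements are singled out by formulas among these
    tuples is definable from C1 ([definable_from_C]); this yields the
    projective space, the affine space and B1.  For B1 the lines through b must
    be added when b is on H: they are the lines none of whose parallels belongs
    to C1 ([pole_direction]).

    Conversely C1 is a substructure of B1.  If b is on H, a line of B1 misses b
    exactly when some point is near to two of its points, nearness now being
    taken with respect to B1 ([lnC_in_B]); if b is off H no line of B1 passes
    through b. *)

(** * Symmetric forms and scalars *)

Section LinearAlgebra.

Variables (F : fieldType) (V : vectType F) (xi : {symmetric V}).

Lemma form_sym u v : xi u v = xi v u.
Proof. by rewrite hermC /= expr0 mul1r. Qed.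

Lemma formDl u v w : xi (u + v) w = xi u w + xi v w.
Proof. exact: linearDl. Qed.

Lemma formDr u v w : xi w (u + v) = xi w u + xi w v.
Proof. exact: linearDr. Qed.

Lemma formZl a u v : xi (a *: u) v = a * xi u v.
Proof. exact: linearZl_LR. Qed.

Lemma formZr a u v : xi u (a *: v) = a * xi u v.
Proof. exact: linearZr_LR. Qed.

(** The map sending x to the vector with coordinates xi x e_i is injective by
    nondegeneracy, hence bijective; it identifies x with the form xi x _. *)
Lemma functional_represented (f : {linear V -> F^o}) :
  nondegenerate xi -> exists x, forall y, xi x y = f y.
Proof.
move=> /eqP xi_nd; pose e := vbasis (fullv : {vspace V}).
pose T (x : V) : V := \sum_(i < \dim {:V}) xi x e`_i *: e`_i.
have T_lin : linear T.
  move=> a u v; rewrite /T scaler_sumr -big_split /=; apply: eq_bigr => i _.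
  by rewrite linearDl linearZl_LR scalerDl scalerA.
pose TL := GRing.isLinear.Build _ _ _ _ T T_lin.
pose T' : {linear V -> V} := HB.pack T TL.
have eE v : v = \sum_(i < \dim {:V}) coord e i v *: e`_i.
  by apply: coord_vbasis; rewrite memvf.
have free_e : free e by exact: (basis_free (vbasisP _)).
have T_coord x (i : 'I_(\dim {:V})) : coord e i (T x) = xi x e`_i.
  by rewrite coord_sum_free.
have T_inj : lker (linfun T') == 0%VS.
  apply/lker0P => x y /eqP; rewrite !lfunE /= -subr_eq0 => /eqP Txy.
  apply/eqP; rewrite -subr_eq0 -memv0 -xi_nd; apply/mem_orthovP => z _.
  rewrite (eE z) linear_sumr big1 //= => i _; rewrite linearZr_LR /= linearBl.
  have h : coord e i (T x - T y) = 0 by rewrite [T x - T y]Txy linear0.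
  move: h; rewrite linearB /= !T_coord => h.
  exact: (etrans (congr1 _ h) (mulr0 _)).
exists ((linfun T')^-1 (\sum_(i < \dim {:V}) f e`_i *: e`_i))%VF => y.
set x := (X in xi X y); have Tx : T x = \sum_(i < \dim {:V}) f e`_i *: e`_i.
  by have := lker0_lfunVK T_inj (\sum_(i < \dim {:V}) f e`_i *: e`_i); rewrite lfunE.
rewrite (eE y) linear_sumr linear_sum /=; apply: eq_bigr => i _.
rewrite linearZr_LR linearZ; congr (_ * _).
transitivity (coord e i (T x)); first by rewrite T_coord.
rewrite Tx coord_sum_free //.
Qed.

(** The source of points in prescribed position: the coordinate forms of a free
    family are defined on the whole space, so any values on the family are those
    of a linear form. *)
Lemma prescribed_values (X : seq V) (c : seq F) : nondegenerate xi ->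
  free X -> exists x, forall i, (i < size X)%N -> xi x X`_i = c`_i.
Proof.
move=> xi_nd freeX; pose Y := in_tuple X.
pose f y : F^o := \sum_(j < size X) c`_j * coord Y j y.
have f_lin : linear f.
  move=> a u v; rewrite /f scaler_sumr -big_split /=; apply: eq_bigr => i _.
  by rewrite linearD linearZ /= mulrDr mulrCA.
pose f' : {linear V -> F^o} :=
  HB.pack f (GRing.isLinear.Build _ _ _ _ f f_lin).
have [x xP] := functional_represented f' xi_nd.
exists x => i ltiX; rewrite xP /= /f (bigD1 (Ordinal ltiX)) //=.
rewrite (coord_free (X := Y) (Ordinal ltiX)) // eqxx mulr1 big1 ?addr0 // => j neqji.
by rewrite (coord_free (X := Y) (Ordinal ltiX)) // eq_sym (negbTE neqji) mulr0.
Qed.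

Lemma point_vector (p : {vspace V}) : is_point p -> exists2 u, u != 0 & p = <[u]>%VS.
Proof.
move=> pp; have u0 : vpick p != 0 by rewrite vpick0 -dimv_eq0 (eqP pp).
exists (vpick p) => //; apply/esym/eqP.
by rewrite eqEdim dim_vline u0 (eqP pp) andbT -memvE memv_pick.
Qed.

(** The points of the line <u, v> are <v> and the <u + t v>, so six points force
    five scalars. *)
Lemma scalar_outside (s : seq F) : lines_have_at_least V 6 ->
  (2 <= \dim {:V})%N -> (size s <= 4)%N -> exists t, t \notin s.
Proof.
move=> lines6 dimV size_s; apply: NNPP => all_s.
have in_s t : t \in s by apply/negP => /negP ts; apply: all_s; exists t.
pose e := vbasis (fullv : {vspace V}).
have free_e : free e := basis_free (vbasisP _).
pose u := e`_0; pose v := e`_1.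
have se : size e = \dim {:V} by rewrite size_tuple.
have freeuv : free [:: u; v].
  move: free_e; rewrite -[X in free X](cat_take_drop 2) => /catl_free.
  have -> // : take 2 e = [:: u; v].
  rewrite /u /v; move: se dimV; case: (tval e) => [|a [|c r]] /= <- //=.
  by rewrite take0.
have [|q [uq sq]] := lines6 <<[:: u; v]>>%VS; first by rewrite /is_line (eqP freeuv).
move=> /allP qP.
pose r := <[v]>%VS :: [seq <[u + t *: v]>%VS | t <- s].
have /(uniq_leq_size uq) : {subset q <= r}.
  move=> p /qP/andP[pp lep]; have [w w0 pw] := point_vector pp.
  have wp : w \in p by rewrite pw memv_line.
  have := subvP lep w wp; rewrite span_cons span_seq1.
  move=> /memv_addP[_ /vlineP[a ->] [_ /vlineP[d ->] def_w]].
  rewrite inE; have [a0|a0] := eqVneq a 0; apply/orP; [left|right].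
    move: def_w; rewrite a0 scale0r add0r => def_w; rewrite pw eqEdim.
    rewrite -memvE def_w memvZ ?memv_line // -def_w !dim_vline w0 leq_b1 //.
  apply/mapP; exists (a^-1 * d); rewrite ?in_s // pw; apply/eqP.
  have def_w' : a^-1 *: w = u + (a^-1 * d) *: v.
    by rewrite def_w scalerDr !scalerA mulVf // scale1r.
  rewrite -def_w' eq_sym eqEdim -memvE memvZ ?memv_line //.
  by rewrite !dim_vline w0 scaler_eq0 invr_eq0 negb_or a0 w0.
by rewrite sq /= size_map ltnS => /leq_trans/(_ size_s).
Qed.

(** Where the linear form xi _ b0 vanishes, so does the additive map u |-> xi u u;
    subtracting a multiple of a vector u1 with xi u1 u1 <> 0 shows that the
    latter is a constant times the square of the former.  Perfectness makes the
    constant a square, which is absorbed into the vector chosen on b. *)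
Lemma pole_vector b : 2%N \in [pchar F] -> perfect_field F ->
  ~ alternating xi -> pole_of_H xi b ->
  exists bv, b = <[bv]>%VS /\ forall u, xi u u = xi u bv ^+ 2.
Proof.
move=> charF perfF nalt [ptb poleb]; have [b0 b0n0 def_b] := point_vector ptb.
have kerP u : xi u b0 = 0 <-> xi u u = 0.
  have [-> |u0] := eqVneq u 0; first by rewrite !linear0l.
  have ptu : is_point <[u]>%VS by rewrite /is_point dim_vline u0.
  have := poleb _ ptu; rewrite /on_H /perp def_b !orthov11.
  by move=> [h1 h2]; split=> /eqP h; apply/eqP; [have [] := h1 h | apply: h2].
have [u1 u1P] : exists u, xi u u <> 0.
  by apply: NNPP => h; apply: nalt => u; apply: NNPP => h'; apply: h; exists u.
have xi1 : xi u1 b0 != 0 by apply/eqP => /kerP.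
have add2 (x : F) : x + x = 0 by rewrite addrr_pchar2.
have sqD u v : xi (u + v) (u + v) = xi u u + xi v v.
  rewrite formDl !formDr (form_sym v u) -addrA [X in _ + X]addrA add2.
  by rewrite add0r.
have sqZ a u : xi (a *: u) (a *: u) = a ^+ 2 * xi u u.
  by rewrite formZl formZr mulrA expr2.
have [s sP] := perfF _ charF (xi u1 u1 / xi u1 b0 ^+ 2).
have sn0 : s != 0.
  apply/eqP => s0; apply: u1P; move/eqP: sP; rewrite s0 expr0n /=.
  by rewrite mulf_eq0 invr_eq0 expf_eq0 /= (negPf xi1) orbF => /eqP.
exists (s *: b0); split.
  apply/eqP; rewrite def_b eq_sym eqEdim -memvE memvZ ?memv_line //.
  by rewrite !dim_vline scaler_eq0 (negPf sn0) leqnn.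
move=> u; pose a := xi u b0 / xi u1 b0.
have /kerP : xi (u - a *: u1) b0 = 0.
  by rewrite -scaleNr formDl formZl /a mulNr divfK ?subrr.
rewrite -scaleNr sqD sqZ sqrrN => /eqP; rewrite addr_eq0 oppr_pchar2 // => /eqP->.
transitivity (s ^+ 2 * xi u b0 ^+ 2); last by rewrite formZr exprMn.
by rewrite -sP /a; field.
Qed.

End LinearAlgebra.

(** * Formulas and definable relations *)

Section Formulas.

Variables (F : fieldType) (V : vectType F) (M : structure V).

Fixpoint rename X (phi : formula (sig M) X) : forall Y, (X -> Y) -> formula (sig M) Y :=
  match phi in formula _ X return forall Y, (X -> Y) -> formula (sig M) Y with
  | FEq _ x y => fun Y h => FEq _ (h x) (h y)
  | FRel _ s a => fun Y h => FRel (fun i => h (a i))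
  | FNot _ f => fun Y h => FNot (rename f h)
  | FAnd _ f g => fun Y h => FAnd (rename f h) (rename g h)
  | FOr _ f g => fun Y h => FOr (rename f h) (rename g h)
  | FEx _ f => fun Y h => FEx (rename f (omap h))
  | FAll _ f => fun Y h => FAll (rename f (omap h))
  end.

Lemma sat_rename X (phi : formula (sig M) X) Y (h : X -> Y) e :
  sat (rename phi h) e <-> sat phi (fun x => e (h x)).
Proof.
have bindE X' Y' (h' : X' -> Y') x (e' : Y' -> {vspace V}) :
    (fun v => bind_var x e' (omap h' v)) = bind_var x (fun v => e' (h' v)).
  by apply: functional_extensionality => -[].
elim: phi Y h e => {X} //=.
- by move=> X f IH Y h e; rewrite IH.
- by move=> X f IHf g IHg Y h e; rewrite IHf IHg.
- by move=> X f IHf g IHg Y h e; rewrite IHf IHg.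
- move=> X f IH Y h e; split=> -[x Mx].
    by rewrite IH bindE; exists x.
  by exists x => //; rewrite IH bindE.
- move=> X f IH Y h e; split=> he x Mx; have := he x Mx; by rewrite IH bindE.
Qed.

End Formulas.

Section PointLineFormulas.

Variables (F : fieldType) (V : vectType F) (pt ln : {vspace V} -> Prop).
Local Notation M := (point_line_structure pt ln).

Definition FPoint X (x : X) : formula (sig M) X :=
  @FRel (sig M) X SPoint (fun=> x).
Definition FIn X (x y : X) : formula (sig M) X :=
  @FRel (sig M) X SInc (fun i : 'I_2 => if (i : nat) is 0 then x else y).
Definition FImp X (f g : formula (sig M) X) := FNot (FAnd f (FNot g)).

Lemma sat_imp X (f g : formula (sig M) X) e :
  sat (FImp f g) e <-> (sat f e -> sat g e).
Proof. by split=> /= h; [move=> sf; apply: NNPP => ng; apply: h | case=> /h]. Qed.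

Lemma sat_all_imp X (f g : formula (sig M) (option X)) e :
  sat (FAll (FImp f g)) e <->
  forall x, elt M x -> sat f (bind_var x e) -> sat g (bind_var x e).
Proof. by split=> h x Mx; apply/sat_imp; apply: h. Qed.

(** Environments take points only as values, since elements of other structures
    will be coded by tuples of points.  The type of variables is arbitrary, so
    closure under a quantifier is stated in the context extended by [None]. *)
Definition definable X (R : (X -> {vspace V}) -> Prop) : Prop :=
  exists phi : formula (sig M) X,
    forall e, (forall x, pt (e x)) -> sat phi e <-> R e.

Implicit Types (X Y : Type).

Lemma definable_ext X (R R' : (X -> {vspace V}) -> Prop) :
  (forall e, (forall x, pt (e x)) -> R e <-> R' e) ->
  definable R -> definable R'.
Proof.
by move=> RR' [phi phiP]; exists phi => e pe; rewrite phiP // RR'.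
Qed.

Lemma definable_eq X (x y : X) : definable (fun e => e x = e y).
Proof. by exists (FEq _ x y). Qed.

Lemma definable_not X (R : (X -> {vspace V}) -> Prop) :
  definable R -> definable (fun e => ~ R e).
Proof. by case=> phi phiP; exists (FNot phi) => e pe /=; rewrite phiP. Qed.

Lemma definable_and X (R R' : (X -> {vspace V}) -> Prop) :
  definable R -> definable R' -> definable (fun e => R e /\ R' e).
Proof.
case=> phi phiP [psi psiP]; exists (FAnd phi psi) => e pe /=.
by rewrite phiP // psiP.
Qed.

Lemma definable_or X (R R' : (X -> {vspace V}) -> Prop) :
  definable R -> definable R' -> definable (fun e => R e \/ R' e).
Proof.
case=> phi phiP [psi psiP]; exists (FOr phi psi) => e pe /=.
by rewrite phiP // psiP.
Qed.

Lemma definable_imp X (R R' : (X -> {vspace V}) -> Prop) :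
  definable R -> definable R' -> definable (fun e => R e -> R' e).
Proof.
case=> phi phiP [psi psiP]; exists (FImp phi psi) => e pe.
by rewrite sat_imp phiP // psiP.
Qed.

Lemma definable_ex X (R : {vspace V} -> (X -> {vspace V}) -> Prop) :
  definable (fun e : option X -> _ => R (e None) (fun x => e (Some x))) ->
  definable (fun e => exists2 p, pt p & R p e).
Proof.
case=> phi phiP; exists (FEx (FAnd (FPoint None) phi)) => e pe /=.
have E p : pt p -> sat phi (bind_var p e) <-> R p e.
  by move=> pp; rewrite phiP //; case.
split=> [[p _ [pp]]|[p pp]]; first by rewrite E //; exists p.
by rewrite -E //; exists p; [left|].
Qed.

Lemma definable_all X (R : {vspace V} -> (X -> {vspace V}) -> Prop) :
  definable (fun e : option X -> _ => R (e None) (fun x => e (Some x))) ->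
  definable (fun e => forall p, pt p -> R p e).
Proof.
move=> /definable_not/(definable_ex (R := fun p e => ~ R p e))/definable_not.
apply: definable_ext => e _.
by split=> [h p pp|h [p pp]]; [apply: NNPP => nR; apply: h; exists p | apply; apply: h].
Qed.

Lemma definable_const X (P : Prop) : definable (fun _ : X -> _ => P).
Proof.
have [p|np] := classic P; first exists (FAll (FEq _ None None)) => e _ /=.
  by split.
by exists (FNot (FAll (FEq _ None None))) => e _ /=; split=> // h; case: h.
Qed.

Lemma definable_all_in X (T : eqType) (s : seq T) (R : T -> (X -> {vspace V}) -> Prop) :
  (forall a, definable (R a)) ->
  definable (fun e => forall a, a \in s -> R a e).
Proof.
move=> dR; elim: s => [|a s IH].
  by apply: definable_ext (definable_const _ True).
apply: definable_ext (definable_and (dR a) IH) => e _; split.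
  by move=> [ha hs] c; rewrite inE => /predU1P[->|/hs].
by move=> h; split=> [|c cs]; apply: h; rewrite inE ?eqxx // cs orbT.
Qed.

Definition joined x y z :=
  exists L, [/\ ln L, (x <= L)%VS, (y <= L)%VS & (z <= L)%VS].

Lemma definable_joined X (x y z : X) :
  definable (fun e => joined (e x) (e y) (e z)).
Proof.
exists (FEx (FAnd (FIn (Some x) None) (FAnd (FIn (Some y) None) (FIn (Some z) None)))).
move=> e pe /=; split=> [[L _ [[_ lnL xL] [[_ _ yL] [_ _ zL]]]]|[L [lnL xL yL zL]]].
  by exists L.
by exists L; [right|].
Qed.

End PointLineFormulas.

(** * Substructures *)

Section Substructure.

Variables (F : fieldType) (V : vectType F).
Variables (pt ln pt' ln' : {vspace V} -> Prop).
Hypothesis pt_point : forall p, pt p -> is_point p.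
Hypothesis ln_line : forall L, ln L -> is_line L.
Hypothesis sub_pt : forall p, pt' p -> pt p.
Hypothesis sub_ln : forall L, ln' L -> ln L.
Local Notation M := (point_line_structure pt ln).
Local Notation N := (point_line_structure pt' ln').

Lemma point_not_line x : pt x -> ln x -> False.
Proof.
by move=> /pt_point/eqP dx /ln_line; rewrite /is_line dx.
Qed.

Lemma elt_le x y : elt M x -> elt M y ->
  (x <= y)%VS <-> x = y \/ [/\ pt x, ln y & (x <= y)%VS].
Proof.
move=> Mx My; split=> [xy|[->|[]]] //.
have dimE : \dim x = \dim y -> x = y by move=> dxy; apply/eqP; rewrite eqEdim xy dxy leqnn.
case: Mx My (dimvS xy) => [px|lx] [py|ly]; last 1 first.
- by left; apply: dimE; rewrite (eqP (ln_line lx)) (eqP (ln_line ly)).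
- by left; apply: dimE; rewrite (eqP (pt_point px)) (eqP (pt_point py)).
- by right.
by rewrite (eqP (ln_line lx)) (eqP (pt_point py)).
Qed.

(** Each element represents itself.  Dimension separates points from lines, so
    inclusion between elements is equality or incidence, and the primitive
    relations of the smaller structure are restrictions of the larger ones. *)
Lemma substructure_definable (phi : formula (sig M) 'I_1) :
  (forall t, elt M (t ord0) -> sat phi t <-> pt' (t ord0) \/ ln' (t ord0)) ->
  definable_in N M.
Proof.
move=> phiP; have Nsub x : pt' x \/ ln' x -> elt M x.
  by case=> [/sub_pt|/sub_ln]; [left|right].
have domP t : in_dom phi t <-> pt' (t ord0) \/ ln' (t ord0).
  split=> [[Mt st]|Nt]; first exact/phiP.
  by split=> [a|]; [rewrite ord1; apply: Nsub | apply/phiP => //; apply: Nsub].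
exists unit, (fun=> 1%N), (fun=> phi),
  (fun _ _ => FEq _ (inl ord0) (inr ord0)), (fun _ t => t ord0).
split.
- split=> [_ t /domP //|y Ny]; exists tt, (fun=> y); split=> //; exact/domP.
- by [].
- case=> c.
  + exists (FPoint pt ln (existT _ ord0 ord0)) => t tP /=.
    have /domP Nt := tP ord0; split=> [pt_t|/sub_pt//].
    by case: Nt => // /sub_ln lt; case: (point_not_line pt_t lt).
  + exists (@FRel (sig M) _ SLine (fun=> existT _ ord0 ord0)) => t tP /=.
    have /domP Nt := tP ord0; split=> [ln_t|/sub_ln//].
    by case: Nt => // /sub_pt p_t; case: (point_not_line p_t ln_t).
  exists (FIn pt ln (existT _ ord0 ord0) (existT _ ord_max ord0)) => t tP /=.
  have /domP Nt := tP ord0; have /domP Nu := tP ord_max; split.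
    move=> [p_t ln_u tu]; split=> //.
      by case: Nt => // /sub_ln lt; case: (point_not_line p_t lt).
    by case: Nu => // /sub_pt p_u; case: (point_not_line p_u ln_u).
  by move=> [/sub_pt p_t /sub_ln ln_u tu].
- move=> _; exists (FOr (FEq _ None (Some ord0)) (FIn pt ln None (Some ord0))).
  move=> x t Mx /domP Nt.
  by rewrite (elt_le Mx (Nsub _ Nt)).
move=> _; exists (FOr (FEq _ (Some ord0) None) (FIn pt ln (Some ord0) None)).
move=> x t Mx /domP Nt.
by rewrite (elt_le (Nsub _ Nt) Mx).
Qed.

End Substructure.

(** * Points off H as vectors of an affine hyperplane *)

Section Geometry.

Variables (F : fieldType) (V : vectType F) (xi : {symmetric V}) (bv : V).
Hypothesis charF : 2%N \in [pchar F].
Hypothesis outside : forall s : seq F, (size s <= 4)%N -> exists t, t \notin s.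
Hypothesis dimV : (2 <= \dim {:V})%N.
Hypothesis xi_nd : nondegenerate xi.
Hypothesis xi_sq : forall u, xi u u = xi u bv ^+ 2.
Local Notation b := <[bv]>%VS.
Local Notation H := (orthov xi b).
Hypothesis b_point : is_point b.

Lemma formBl u v w : xi (u - v) w = xi u w - xi v w.
Proof. exact: linearBl. Qed.

Lemma formBr u v w : xi w (u - v) = xi w u - xi w v.
Proof. exact: linearBr. Qed.

Lemma formNl u v : xi (- u) v = - xi u v.
Proof. exact: linearNl. Qed.

Lemma formNr u v : xi u (- v) = - xi u v.
Proof. exact: linearNr. Qed.

Definition formE := (formDl, formDr, formNl, formNr, formZl, formZr).

(** Turns identities between vectors into identities between scalars. *)
Lemma form_ext u v : (forall x, xi u x = xi v x) -> u = v.
Proof.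
move=> uv; apply/eqP; rewrite -subr_eq0 -memv0 -(eqP xi_nd).
by apply/mem_orthovP => x _; rewrite formBl uv subrr.
Qed.

Lemma add_eq_self (a x : F) : a + x = a -> x = 0.
Proof. by move=> h; apply: (addrI a); rewrite h addr0. Qed.

(** Every point off H has exactly one such vector. *)
Definition affine (u : V) := xi u bv = 1.
Definition affine_col (u v w : V) := exists t, w = u + t *: (v - u).
(** The vector form of not being joined by a line of C1: the first alternative
    describes nonregular lines, the second one lines through b. *)
Definition vnear (u v : V) := xi u v = 1 \/ exists t, v = u + t *: bv.

Lemma affine_self u : affine u -> xi u u = 1.
Proof. by rewrite xi_sq => ->; rewrite expr1n. Qed.

(** The two values say that b lies on H, respectively off H. *)
Lemma pole_self : xi bv bv = 0 \/ xi bv bv = 1.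
Proof.
have /eqP := xi_sq bv; rewrite expr2 -subr_eq0 -[X in X - _]mulr1 -mulrBr.
by rewrite mulf_eq0 subr_eq0 => /orP[/eqP->|/eqP<-]; [left|right].
Qed.

Lemma add_in_line (u v x : V) :
  reflect (exists a c, x = a *: u + c *: v) (x \in <[u]> + <[v]>)%VS.
Proof.
apply: (iffP memv_addP) => [[_ /vlineP[a ->] [_ /vlineP[c ->] ->]]|[a [c ->]]].
  by exists a, c.
by exists (a *: u); rewrite ?memvZ ?memv_line //; exists (c *: v); rewrite ?memvZ ?memv_line.
Qed.

Lemma affine_colP u v w : affine u -> affine v -> affine w ->
  affine_col u v w <-> w \in (<[u]> + <[v]>)%VS.
Proof.
move=> au av aw; split=> [[t ->]|/add_in_line[a [c def_w]]].
  apply/add_in_line; exists (1 - t), t; apply: form_ext => x; rewrite !formE; ring.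
move: (aw); rewrite /affine def_w !formE au av !mulr1 => ac.
exists c; apply: form_ext => x; rewrite !formE -[a](addrK c) ac; ring.
Qed.

Lemma affine_eq (u v : V) k : affine u -> affine v -> u = k *: v -> u = v.
Proof.
by move=> au av def_u; move: au; rewrite /affine def_u formZl av mulr1 => ->; rewrite scale1r.
Qed.

Lemma free_pole u v : affine u -> affine v -> u <> v ->
  bv \notin (<[u]> + <[v]>)%VS -> free [:: bv; u; v].
Proof.
move=> au av uv buv; rewrite !free_cons span_nil nil_free span_cons span_seq1.
rewrite buv /= andbT memv0; apply/andP; split.
  by apply/vlineP => -[k /(affine_eq au av)].
by apply/eqP => v0; move: av; rewrite /affine v0 linear0l => /eqP; rewrite eq_sym oner_eq0.
Qed.

Lemma vnear_sym u v : vnear u v -> vnear v u.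
Proof.
case=> [uv|[t ->]]; first by left; rewrite form_sym.
by right; exists (- t); rewrite scaleNr addrK.
Qed.

Lemma vnear_refl u : affine u -> vnear u u.
Proof. by left; apply: affine_self. Qed.

(** If v = u + g bv, the vectors near to u and v are the u + t bv, which are
    pairwise near.  Otherwise xi u v = 1, and the vectors x near to both of u and
    v satisfy xi x u = xi x v = 1; a vector w with xi x w = 1 for all of them lies
    in the double orthogonal complement <bv, u, v>, and evaluating at one such x
    removes the component along bv. *)
Lemma col_of_double_near u v w : xi bv bv = 0 ->
  affine u -> affine v -> affine w -> u <> v -> vnear u v ->
  affine_col u v w <->
  forall x, affine x -> vnear x u -> vnear x v -> vnear x w.
Proof.
move=> b0 au av aw uv nuv; split.
  move=> [t def_w] x ax.
  have [[g def_v]|nb] := classic (exists g, v = u + g *: bv).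
    have ww : w = u + (t * g) *: bv.
      by apply: form_ext => z; rewrite def_w def_v !formE; ring.
    case=> [xu|[d def_u]].
      case=> [xv|[d def_v']]; last first.
        right; exists (d - g + t * g); apply: form_ext => z.
        have := congr1 (xi^~ z) def_v; rewrite {1}def_v' ww !formE => h.
        have -> : xi u z = xi x z + d * xi bv z - g * xi bv z by rewrite h; ring.
        ring.
      left; move: xv; rewrite def_v ww !formE xu ax mulr1 => /add_eq_self->; ring.
    by move=> _; right; exists (d + t * g); apply: form_ext => z; rewrite ww def_u !formE; ring.
  have {nuv}uv1 : xi u v = 1 by case: nuv.
  case=> [xu|[d def_u]]; case=> [xv|[d' def_v]].
  - by left; rewrite def_w !formE xu xv; ring.
  - left; move: uv1; rewrite def_v !formE (form_sym xi u) xu au mulr1 => /add_eq_self d0.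
    by rewrite def_w def_v d0 !formE xu affine_self //; ring.
  - left; move: uv1; rewrite def_u !formE xv (form_sym xi bv) av mulr1 => /add_eq_self d0.
    by rewrite def_w def_u d0 !formE xv affine_self //; ring.
  - right; exists (d + t * (d' - d)); apply: form_ext => z.
    by rewrite def_w def_u def_v !formE; ring.
move=> H; have nuw := H u au (vnear_refl au) nuv.
have nvw := H v av (vnear_sym nuv) (vnear_refl av).
have [[g def_v]|nb] := classic (exists g, v = u + g *: bv).
  have g0 : g != 0 by apply/eqP => g0; apply: uv; rewrite def_v g0 scale0r addr0.
  suff [d ->] : exists d, w = u + d *: bv.
    by exists (d / g); apply: form_ext => z; rewrite def_v !formE; field.
  case: nuw => // uw; case: nvw => [vw|[d ->]]; last first.
    by exists (g + d); rewrite def_v scalerDl addrA.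
  case/eqP: g0; move: vw; rewrite def_v !formE uw (form_sym xi bv) aw mulr1.
  by move/add_eq_self.
have {nuv}uv1 : xi u v = 1 by case: nuv.
have bline x y t : affine x -> xi x y = 1 -> y = x + t *: bv -> y = x.
  move=> ax xy def_y; move: xy; rewrite def_y !formE affine_self // ax mulr1.
  by move=> /add_eq_self->; rewrite scale0r addr0.
have {}H x : affine x -> xi x u = 1 -> xi x v = 1 -> xi x w = 1.
  move=> ax xu xv; case: (H x ax) => [||//|[d def_w]]; try by left.
  have cl y : affine y -> xi x y = 1 -> vnear y w -> xi x w = 1 \/ x = y.
    move=> ay xy [yw|[g def_w']].
      left; move: yw; rewrite {1}def_w !formE (form_sym xi y) xy ay mulr1 => /add_eq_self d0.
      by rewrite def_w d0 scale0r addr0 affine_self.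
    right; apply/esym/(bline x y (d - g)) => //; apply: form_ext => z.
    have := congr1 (xi^~ z) def_w; rewrite {1}def_w' !formE => h.
    have -> : xi y z = xi x z + d * xi bv z - g * xi bv z by rewrite -h; ring.
    ring.
  by case: (cl u au xu nuw) => // xu'; case: (cl v av xv nvw) => // xv'; case: uv; rewrite -xu'.
(* a relation between bv, u and v would put v on the line through u and b *)
have fr : free [:: bv; u; v].
  apply: free_pole => //; apply/add_in_line => -[a [c def_b]].
  have ac : a = - c.
    apply/eqP; rewrite -addr_eq0; apply/eqP.
    by have := congr1 (xi^~ bv) def_b; rewrite !formE b0 au av !mulr1.
  have c0 : c != 0.
    apply/eqP => c0; have := congr1 (xi u) def_b.
    rewrite ac c0 oppr0 !scale0r addr0 au linear0r => /eqP; by rewrite oner_eq0.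
  apply: nb; exists c^-1; rewrite def_b ac; apply: form_ext => z; rewrite !formE; field.
  exact: c0.
have [x0 x0P] := prescribed_values [:: 1; 1; 1] xi_nd fr.
have /= x0b := x0P 0%N isT; have /= x0u := x0P 1%N isT; have /= x0v := x0P 2%N isT.
have x0w := H x0 x0b x0u x0v.
have : w \in <<[:: bv; u; v]>>%VS.
  apply/negP => /negP wn; have fr4 : free [:: w; bv; u; v] by rewrite free_cons wn.
  have [y yP] := prescribed_values [:: 1; 0; 0; 0] xi_nd fr4.
  have /= yw := yP 0%N isT; have /= yb := yP 1%N isT.
  have /= yu := yP 2%N isT; have /= yv := yP 3%N isT.
  have := H (x0 + y); rewrite /affine !formE x0b x0u x0v yb yu yv !addr0 x0w yw.
  by move=> /(_ erefl erefl erefl)/add_eq_self/eqP; rewrite oner_eq0.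
rewrite span_cons span_cons span_seq1.
move=> /memv_addP[_ /vlineP[d ->] [_ /add_in_line[a [c ->]] def_w]].
have h1 := congr1 (xi^~ bv) def_w; have h2 := congr1 (xi x0) def_w.
rewrite !formE b0 au av !mulr1 mulr0 add0r aw in h1.
rewrite !formE x0w x0b x0u x0v !mulr1 -h1 in h2.
have d0 : d = 0 by apply: (add_eq_self (a := 1)); rewrite addrC -h2.
exists c; apply: form_ext => x; rewrite def_w d0 !formE -[a](addrK c) -h1; ring.
Qed.

(** Since bv is orthogonal to u - bv and to v - bv and does not lie in H, the
    condition says that the same vectors are orthogonal to both of them, which
    happens exactly when they are proportional. *)
Lemma pole_line_of_near u v : xi bv bv = 1 -> affine u -> affine v ->
  u <> bv -> v <> bv ->
  (exists c, v = bv + c *: (u - bv)) <->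
  forall x, affine x -> x <> bv -> xi x u = 1 <-> xi x v = 1.
Proof.
move=> b1 au av ub vb; split=> [[c def_v] x ax _|H].
  have c0 : c != 0 by apply/eqP => c0; apply: vb; rewrite def_v c0 scale0r addr0.
  rewrite def_v !formE ax; split=> [->|]; first by ring.
  by move=> /add_eq_self/eqP; rewrite mulf_eq0 (negPf c0) subr_eq0 => /eqP.
apply: NNPP => nv; have fr : free [:: v - bv; u - bv].
  rewrite free_cons seq1_free span_seq1 subr_eq0; apply/andP; split; last exact/eqP.
  by apply/vlineP => -[c def_v]; apply: nv; exists c; rewrite -def_v addrC subrK.
have [y yP] := prescribed_values [:: 1; 0] xi_nd fr.
have /= yv := yP 0%N isT; have /= yu := yP 1%N isT.
pose x := y + (1 - xi y bv) *: bv.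
have bu : xi bv u = 1 by rewrite form_sym.
have bvv : xi bv v = 1 by rewrite form_sym.
have xb : xi x bv = 1 by rewrite /x !formE b1; ring.
have xu : xi x u = 1.
  by rewrite -[LHS](subrK (xi x bv)) -formBr xb /x !formE b1 bu -formBr yu; ring.
have xv : xi x v = 1 + 1.
  by rewrite -[LHS](subrK (xi x bv)) -formBr xb /x !formE b1 bvv -formBr yv; ring.
have x_b : x <> bv.
  by move=> xb'; move/eqP: xv; rewrite xb' bvv -subr_eq0 opprD addNKr oppr_eq0 oner_eq0.
have [/(_ xu) /eqP h _] := H x xb x_b.
by move: h; rewrite xv -subr_eq0 addrK oner_eq0.
Qed.

(** Soundness: the points of the triangle lie in the plane of c, u, v, where the
    equation xi w u = 1 cuts out the line through u and v because xi c u <> 1.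
    Completeness: take xi c u = 0 and xi c v = 1 + ta; the points p, q, r
    are the images of u, v, w under the homothety of center c and ratio l, and
    xi p q = 1 + l (1 - l) (ta - 1). *)
Lemma col_of_triangle u v w :
  affine u -> affine v -> affine w -> xi u v = 1 -> free [:: bv; u; v] ->
  affine_col u v w <-> xi w u = 1 /\
    exists c p q r,
    [/\ [/\ affine c, affine p, affine q & affine r],
        xi c u <> 1 /\ affine_col c u p, xi c v <> 1 /\ affine_col c v q,
        xi p q <> 1 /\ affine_col p q r & xi c r <> 1 /\ affine_col c r w].
Proof.
move=> au av aw uv fr; split.
  move=> [t def_w]; split.
    by rewrite def_w !formE affine_self // (form_sym xi v) uv; ring.
  (* ta <> 0 and 1 + ta <> t^-1 keep v and w from being near to c; ta <> 1 does it
     for p and q *)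
  have [ta] := outside (s := [:: 0; 1; t^-1 - 1]) isT.
  rewrite !inE !negb_or => /and3P[ta0 ta1 tat].
  have [l] := outside (s := [:: 0; 1]) isT; rewrite !inE !negb_or => /andP[l0 l1].
  have [c cP] := prescribed_values [:: 1; 0; 1 + ta] xi_nd fr.
  have /= cb := cP 0%N isT; have /= cu := cP 1%N isT; have /= cv := cP 2%N isT.
  have cw : xi c w <> 1.
    rewrite def_w !formE cu cv => h.
    have t0 : t != 0.
      by apply/eqP => t0; move/eqP: h; rewrite t0 mul0r addr0 eq_sym oner_eq0.
    case/eqP: tat; apply: (mulfI t0); rewrite mulrBr mulfV // mulr1 -h; ring.
  have lerp_affine x : affine x -> affine (c + l *: (x - c)).
    by rewrite /affine !formE cb => ->; ring.
  have lerp_far x : xi c x <> 1 -> xi c (c + l *: (x - c)) <> 1.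
    move=> cx; rewrite !formE affine_self // => /add_eq_self/eqP.
    by rewrite mulf_eq0 (negPf l0) subr_eq0 => /eqP.
  exists c, (c + l *: (u - c)), (c + l *: (v - c)), (c + l *: (w - c)); split.
  - by split=> //; apply: lerp_affine.
  - split; last by exists l.
    by rewrite cu => /eqP; rewrite eq_sym oner_eq0.
  - split; last by exists l.
    by rewrite cv => /add_eq_self/eqP; rewrite (negPf ta0).
  - split.
      rewrite !formE (form_sym xi u c) cu cv uv affine_self // => h.
      have /eqP : l * (1 - l) * (ta - 1) = 0 by rewrite -[RHS](subrr 1) -[X in _ = X - _]h; ring.
      by rewrite !mulf_eq0 !subr_eq0 (negPf l0) eq_sym (negPf l1) (negPf ta1).
    by exists t; apply: form_ext => z; rewrite def_w !formE; ring.
  - split; first exact: lerp_far.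
    by exists l^-1; apply: form_ext => z; rewrite !formE; field.
move=> [wu [c [p [q [r [[ac ap aq ar] [cu [a def_p]] [cv [d def_q]]]]]]]].
move=> [pq [e def_r]] [cr [s def_w]].
(* barycentric coordinates of w in the triangle c, u, v *)
have ww : w = c + (s * (1 - e) * a) *: (u - c) + (s * e * d) *: (v - c).
  by apply: form_ext => z; rewrite def_w def_r def_p def_q !formE; ring.
set be := s * (1 - e) * a in ww; set ga := s * e * d in ww.
have /eqP : (1 - xi c u) * (be + ga - 1) = 0.
  rewrite -[RHS](subrr 1) -[X in _ = X - _]wu ww !formE (form_sym xi v u) uv affine_self //; ring.
rewrite mulf_eq0 !subr_eq0 => /orP[/eqP h|/eqP bg]; first by case: cu.
exists ga; apply: form_ext => z; rewrite ww !formE -[be](addrK ga) bg; ring.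
Qed.

(** * Points and lines of B1 and C1 *)

Definition ptC p := [/\ is_point p, regular xi p & p <> b].
Definition lnB L := [/\ is_line L, regular xi L & ~ contained_in_H xi L].
Definition lnC L :=
  [/\ is_line L, regular xi L, ~ contained_in_H xi L & ~ (b <= L)%VS].

Local Notation definableC := (definable ptC lnC).
Local Notation MC := (point_line_structure ptC lnC).
Local Notation MB := (point_line_structure ptC lnB).

Lemma affine_neq0 u : affine u -> u != 0.
Proof.
by move=> au; apply/eqP => u0; move/eqP: au; rewrite u0 linear0l eq_sym oner_eq0.
Qed.

Lemma affine_line_inj u v : affine u -> affine v -> <[u]>%VS = <[v]>%VS -> u = v.
Proof.
move=> au av uv; have /vlineP[k] : u \in <[v]>%VS by rewrite -uv memv_line.
exact: (affine_eq au av).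
Qed.

Lemma affine_point u : affine u -> is_point <[u]>%VS.
Proof. by move/affine_neq0 => u0; rewrite /is_point dim_vline u0. Qed.

Lemma affine_scale (u : V) : xi u bv != 0 -> exists2 v, affine v & <[u]>%VS = <[v]>%VS.
Proof.
move=> ub; exists ((xi u bv)^-1 *: u).
  by rewrite /affine formZl mulVf.
apply/eqP; rewrite eq_sym eqEdim -memvE memvZ ?memv_line // !dim_vline.
by rewrite scaler_eq0 invr_eq0 (negPf ub) leqnn.
Qed.

Lemma not_on_H_P p : (is_point p /\ ~ on_H xi p) <-> exists2 u, affine u & p = <[u]>%VS.
Proof.
split=> [[pp pH]|[u au ->]].
  have [u u0 def_p] := point_vector pp.
  have ub : xi u bv != 0.
    apply/eqP => ub; apply: pH; split=> //; rewrite def_p /perp orthov11 xi_sq ub.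
    by rewrite expr0n.
  by have [v av def_u] := affine_scale ub; exists v; rewrite ?def_p.
split; first exact: affine_point.
by case=> _; rewrite /perp orthov11 affine_self ?oner_eq0.
Qed.

Lemma ptCP p : ptC p <-> exists u, [/\ affine u, u <> bv & p = <[u]>%VS].
Proof.
split=> [[pp regp pb]|[u [au ub ->]]].
  have [|u au def_p] := (not_on_H_P p).1.
    split=> //; case=> _ pH; move: regp; rewrite /regular (capv_idPl pH) => p0.
    by move: pp; rewrite /is_point p0 dimv0.
  by exists u; split=> // ub; apply: pb; rewrite def_p ub.
split; first exact: affine_point.
  apply/eqP; rewrite -subv0; apply/subvP => _ /memv_capP[/vlineP[k ->]].
  rewrite mem_orthov1 formZl affine_self // mulr1 => /eqP->.
  by rewrite scale0r mem0v.
move=> ub'; have /vlineP[k def_u] : u \in b by rewrite -ub' memv_line.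
have k0 : k != 0 by apply/eqP => k0; move: (affine_neq0 au); rewrite def_u k0 scale0r eqxx.
have b1 : affine bv.
  rewrite /affine; have [b0|//] := pole_self.
  by move/eqP: au; rewrite /affine def_u formZl b0 mulr0 eq_sym oner_eq0.
exact/ub/(affine_eq au b1 def_u).
Qed.

Lemma affine_line u v : affine u -> affine v -> u <> v -> is_line (<[u]> + <[v]>)%VS.
Proof.
move=> au av uv; have -> : (<[u]> + <[v]> = <<[:: u; v]>>)%VS.
  by rewrite span_cons span_seq1.
rewrite /is_line.
have /eqP -> // : free [:: u; v].
rewrite free_cons seq1_free span_seq1 affine_neq0 // andbT.
by apply/vlineP => -[k /(affine_eq au av)].
Qed.

Lemma line_of_two (L : {vspace V}) u v : is_line L -> affine u -> affine v -> u <> v ->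
  u \in L -> v \in L -> L = (<[u]> + <[v]>)%VS.
Proof.
move=> lL au av uv uL vL; apply/esym/eqP; rewrite eqEdim (eqP lL).
by rewrite (eqP (affine_line au av uv)) andbT subv_add -!memvE uL.
Qed.

Lemma affine_not_contained (L : {vspace V}) u : affine u -> u \in L -> ~ contained_in_H xi L.
Proof.
move=> au uL /(_ _ (affine_point au)); rewrite -memvE => /(_ uL).
by have [_] := (not_on_H_P <[u]>%VS).2 (ex_intro2 _ _ u au erefl).
Qed.

(** The Gram determinant of u, v is 1 - s^2 with s = xi u v, and in characteristic
    2 this is (1 - s)^2. *)
Lemma regular_line u v : affine u -> affine v -> u <> v ->
  regular xi (<[u]> + <[v]>)%VS <-> xi u v <> 1.
Proof.
move=> au av uv; split=> [reg uv1|uv1].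
  suff : u - v \in 0%VS by rewrite memv0 subr_eq0 => /eqP.
  rewrite -reg memv_cap; apply/andP; split.
    by apply/add_in_line; exists 1, (-1); rewrite scale1r scaleN1r.
  apply/mem_orthovP => _ /add_in_line[a [c ->]].
  by rewrite !formE !affine_self // (form_sym xi v) uv1; ring.
apply/eqP; rewrite -subv0; apply/subvP => _ /memv_capP[/add_in_line[a [c ->]]].
move=> /mem_orthovP perp0.
have uL : u \in (<[u]> + <[v]>)%VS by rewrite memvE addvSl.
have vL : v \in (<[u]> + <[v]>)%VS by rewrite memvE addvSr.
have := perp0 u uL; have := perp0 v vL.
rewrite !formE !affine_self // (form_sym xi v u) !mulr1.
set s := xi u v => acv acu.
have s1 : s - 1 != 0 by rewrite subr_eq0; apply/eqP.
have /eqP : c * ((s - 1) * (s - 1)) = 0.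
  rewrite {2}(_ : s - 1 = s + 1); last by rewrite oppr_pchar2.
  transitivity (s * (a + c * s) - (a * s + c)); first by ring.
  by rewrite acu acv mulr0 subr0.
rewrite !mulf_eq0 orbb (negPf s1) orbF => /eqP c0.
by move: acu; rewrite c0 mul0r addr0 => ->; rewrite !scale0r addr0 mem0v.
Qed.

(** If b is off H, a line through b is not regular; if b is on H, then v differs
    from u by a multiple of bv. *)
Lemma near_of_pole_line u v : affine u -> affine v -> u <> v ->
  u <> bv -> bv \in (<[u]> + <[v]>)%VS -> vnear u v.
Proof.
move=> au av uv ub /add_in_line[a [c def_b]].
have c0 : c != 0.
  apply/eqP => c0; apply: ub; move: def_b; rewrite c0 scale0r addr0 => def_b.
  apply/esym; case: pole_self => b1; last exact: (affine_eq b1 au def_b).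
  have := congr1 (xi^~ bv) def_b; rewrite formZl au b1 mulr1 => a0.
  by move: b_point; rewrite def_b -a0 scale0r /is_point dim_vline eqxx.
have bb : xi bv bv = a + c by rewrite {1}def_b !formE au av !mulr1.
case: pole_self => b1.
  right; exists c^-1; rewrite def_b; have -> : a = - c.
    by apply/eqP; rewrite -addr_eq0 -bb b1.
  by apply: form_ext => z; rewrite !formE; field.
left; have := congr1 (xi^~ u) def_b; rewrite !formE affine_self //.
rewrite (form_sym xi bv) au mulr1 -[LHS]b1 bb => /addrI.
by rewrite -{1}[c]mulr1 => /(mulfI c0); rewrite (form_sym xi v) => <-.
Qed.

Lemma lnB_line u v : affine u -> affine v -> u <> v ->
  lnB (<[u]> + <[v]>)%VS <-> xi u v <> 1.
Proof.
move=> au av uv; rewrite -regular_line //; split=> [[]|reg] //.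
split=> //; first exact: affine_line.
by apply: affine_not_contained au _; rewrite memvE addvSl.
Qed.

Lemma lnC_line u v : affine u -> affine v -> u <> v -> u <> bv -> 
  lnC (<[u]> + <[v]>)%VS <-> ~ vnear u v.
Proof.
move=> au av uv ub; split=> [[lL reg nH nb]|nuv].
  have nuv := (regular_line au av uv).1 reg.
  case=> // -[t def_v]; apply: nb; rewrite -memvE; apply/add_in_line.
  have t0 : t != 0 by apply/eqP => t0; apply: uv; rewrite def_v t0 scale0r addr0.
  by exists (- t^-1), (t^-1); apply: form_ext => z; rewrite def_v !formE; field.
have [lL reg nH] : lnB (<[u]> + <[v]>)%VS.
  by apply/lnB_line => // uv1; apply: nuv; left.
by split=> // bL; apply: nuv; apply: near_of_pole_line; rewrite ?memvE.
Qed.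

Lemma joinedC_P u v w : affine u -> affine v -> affine w -> u <> v -> u <> bv ->
  joined lnC <[u]>%VS <[v]>%VS <[w]>%VS <-> ~ vnear u v /\ affine_col u v w.
Proof.
move=> au av aw uv ub; rewrite (affine_colP au av aw) -lnC_line //.
split=> [[L [lnL uL vL wL]]|[lnL wL]].
  rewrite -!memvE in uL vL wL.
  have lL : is_line L by case: lnL.
  by rewrite -(line_of_two lL au av uv uL vL).
by exists (<[u]> + <[v]>)%VS; split; rewrite ?addvSl ?addvSr // -memvE.
Qed.

Definition near p q := p = q \/ ~ joined lnC p q q.

Lemma nearP u v : affine u -> affine v -> u <> bv ->
  near <[u]>%VS <[v]>%VS <-> vnear u v.
Proof.
move=> au av ub; have [<-|uv] := classic (u = v).
  by split=> _; [exact: vnear_refl | left].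
rewrite /near joinedC_P //; split=> [[/(affine_line_inj au av)//|h]|nuv].
  apply: NNPP => nuv; apply: h; split=> //.
  by exists 1; apply: form_ext => z; rewrite !formE; ring.
by right; case.
Qed.

Lemma definable_near X (x y : X) : definableC (fun e => near (e x) (e y)).
Proof.
apply: definable_or; first exact: definable_eq.
by apply: definable_not; apply: definable_joined.
Qed.

Definition pole_line p q := (q <= b + p)%VS.

(** If b is off H, the points on a line through b are told apart from the other
    ones by having the same near points. *)
Lemma pole_line_near p q : affine bv -> ptC p -> ptC q ->
  pole_line p q <-> forall x, ptC x -> (near x p -> near x q) /\ (near x q -> near x p).
Proof.
move=> b1 /ptCP[u [au ub ->]] /ptCP[v [av vb ->]].
have nearE x y : affine x -> affine y -> x <> bv -> near <[x]>%VS <[y]>%VS <-> xi x y = 1.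
  move=> ax ay xb; rewrite nearP //; split=> [|h]; last by left.
  case=> // -[t def_y]; move: ay; rewrite /affine def_y !formE ax b1 mulr1.
  by move=> /add_eq_self ->; rewrite addr0 affine_self.
rewrite /pole_line -memvE -(affine_colP b1 au av) /affine_col pole_line_of_near //.
split=> [H _ /ptCP[x [ax xb ->]]|H x ax xb].
  by rewrite !nearE // (H x ax xb).
have /H : ptC <[x]>%VS by apply/ptCP; exists x.
by rewrite !nearE //; case.
Qed.

Lemma definable_pole_line X (x y : X) : affine bv ->
  definableC (fun e => pole_line (e x) (e y)).
Proof.
move=> b1; apply: (@definable_ext _ _ _ _ _ (fun e => forall p, ptC p ->
  (near p (e x) -> near p (e y)) /\ (near p (e y) -> near p (e x)))).
  by move=> e pe; rewrite (pole_line_near b1).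
apply: definable_all; apply: definable_and; apply: definable_imp; exact: definable_near.
Qed.

(** * Collinearity is definable from C1 *)

Definition joined3 x y z := x <> y /\ joined lnC x y z.

Definition triangle x y z :=
  exists2 c, ptC c & exists2 p, ptC p & exists2 q, ptC q & exists2 r, ptC r &
    (joined3 c x p /\ joined3 c y q) /\ (joined3 p q r /\ joined3 c r z).

Lemma definable_joined3 X (x y z : X) :
  definableC (fun e => joined3 (e x) (e y) (e z)).
Proof.
apply: definable_and; last exact: definable_joined.
apply: definable_not; exact: definable_eq.
Qed.

Lemma definable_triangle X (x y z : X) :
  definableC (fun e => triangle (e x) (e y) (e z)).
Proof.
do 4!apply: definable_ex.
by do 2!apply: definable_and; apply: definable_joined3.
Qed.

Lemma joined3P u v w : affine u -> affine v -> affine w -> u <> bv ->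
  joined3 <[u]>%VS <[v]>%VS <[w]>%VS <-> ~ vnear u v /\ affine_col u v w.
Proof.
move=> au av aw ub; rewrite /joined3; split=> [[uv]|[nuv cw]].
  by rewrite joinedC_P // => uv'; apply: uv; rewrite uv'.
have uv : u <> v by move=> uv; apply: nuv; rewrite uv; exact: vnear_refl.
by split; [move/(affine_line_inj au av) | rewrite joinedC_P].
Qed.

Lemma vnear_pole_affine u v : affine bv -> affine u -> affine v ->
  vnear u v <-> xi u v = 1.
Proof.
move=> b1 au av; split=> [|h]; last by left.
case=> // -[t def_y]; move: av; rewrite def_y /affine !formE au b1 mulr1.
by move=> /add_eq_self ->; rewrite addr0 affine_self.
Qed.

Lemma near_col_of_triangle x y z : affine bv -> ptC x -> ptC y -> ptC z ->
  x <> y -> near x y -> ~ pole_line x y ->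
  (z <= x + y)%VS <-> near z x /\ triangle x y z.
Proof.
move=> b1 /ptCP[u [au ub ->]] /ptCP[v [av vb ->]].
move=> /ptCP[w [aw wb ->]] uv; rewrite !nearP // !vnear_pole_affine //.
have {}uv : u <> v by move=> uv'; apply: uv; rewrite uv'.
rewrite /pole_line -memvE => xi1 nb.
have bn : bv \notin (<[u]> + <[v]>)%VS.
  apply/negP => /(affine_colP au av b1)[t def_b]; apply: nb.
  apply/(affine_colP b1 au av).
  have t0 : t != 0 by apply/eqP => t0; apply: ub; rewrite def_b t0 scale0r addr0.
  exists (1 - t^-1); apply: form_ext => s; rewrite def_b !formE; field.
  exact: t0.
rewrite -memvE -(affine_colP au av aw).
rewrite (col_of_triangle au av aw xi1); last exact: (free_pole au av uv bn).
have neb s s' : affine s' -> xi s s' <> 1 -> s <> bv.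
  by move=> as' h sb; apply: h; rewrite sb form_sym.
have colA s s' s'' : affine s -> affine s' -> affine_col s s' s'' -> affine s''.
  by move=> as0 as' [t ->]; rewrite /affine !formE as0 as'; ring.
split=> [[wu]|[wu]].
  case=> c [p [q [r [[ac ap aq ar] [cu cup] [cv cvq] [pq pqr] [cr crw]]]]].
  have cb := neb _ _ au cu; have pb := neb _ _ aq pq.
  have qb : q <> bv by apply: (neb _ p) => //; rewrite form_sym.
  have rb : r <> bv by apply: (neb _ c) => //; rewrite form_sym.
  split=> //.
  exists <[c]>%VS; first by apply/ptCP; exists c.
  exists <[p]>%VS; first by apply/ptCP; exists p.
  exists <[q]>%VS; first by apply/ptCP; exists q.
  exists <[r]>%VS; first by apply/ptCP; exists r.
  by rewrite !joined3P // !vnear_pole_affine.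
case=> _ /ptCP[c [ac cb ->]] [_ /ptCP[p [ap pb ->]]].
case=> _ /ptCP[q [aq qb ->]] [_ /ptCP[r [ar rb ->]]].
rewrite !joined3P // !vnear_pole_affine // => -[[[cu cup] [cv cvq]] [[pq pqr] [cr crw]]].
by split=> //; exists c, p, q, r.
Qed.

Lemma joined_col x y z : ptC x -> ptC y -> ptC z -> x <> y ->
  joined lnC x y z <-> ~ near x y /\ (z <= x + y)%VS.
Proof.
move=> /ptCP[u [au ub ->]] /ptCP[v [av vb ->]].
move=> /ptCP[w [aw wb ->]] uv.
have {}uv : u <> v by move=> uv'; apply: uv; rewrite uv'.
by rewrite joinedC_P // nearP // -memvE -(affine_colP au av aw).
Qed.

Lemma near_pole_line x y : ptC x -> ptC y -> x <> y -> pole_line x y ->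
  near x y /\ (x + y = b + x)%VS.
Proof.
move=> /ptCP[u [au ub ->]] /ptCP[v [av vb ->]] xy plxy.
have uv : u <> v by move=> uv'; apply: xy; rewrite uv'.
have E : (<[u]> + <[v]> = b + <[u]>)%VS.
  have := plxy; rewrite /pole_line => plv; apply/eqP.
  rewrite eqEdim subv_add addvSr plv /= (eqP (affine_line au av uv)).
  by apply: leq_trans (dimv_add_leqif _ _) _; rewrite !dim_vline; do 2!case: (_ != 0).
split=> //; rewrite nearP //; apply: near_of_pole_line => //.
by rewrite E memvE addvSl.
Qed.

(** Points that are not near are collinear exactly when a line of C1 joins them;
    the formula for near points depends on whether b lies on H. *)
Lemma definable_col X (x y z : X) : definableC (fun e => (e z <= e x + e y)%VS).
Proof.
case: pole_self => b01.
  apply: (@definable_ext _ _ _ _ _ (fun e => (e x = e y /\ e z = e x) \/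
    (~ e x = e y /\ (joined lnC (e x) (e y) (e z) \/ (near (e x) (e y) /\
      (forall p, ptC p -> near p (e x) -> near p (e y) -> near p (e z))))))); last first.
    apply: definable_or; first by apply: definable_and; exact: definable_eq.
    apply: definable_and; first by apply: definable_not; exact: definable_eq.
    apply: definable_or; first exact: definable_joined.
    apply: definable_and; first exact: definable_near.
    apply: definable_all; do 2![apply: definable_imp; first exact: definable_near].
    exact: definable_near.
  move=> e pe; move: (pe x) (pe y) (pe z).
  move=> /ptCP[u [au ub ->]] /ptCP[v [av vb ->]].
  move=> /ptCP[w [aw wb ->]].
  rewrite -memvE -(affine_colP au av aw).
  have bA s : affine s -> s <> bv.
    by move=> as0 sb; move/eqP: as0; rewrite sb /affine b01 eq_sym oner_eq0.
  have [<-|uv] := classic (u = v).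
    split=> [[[_ /(affine_line_inj aw au) ->]|[]]|[t ->]] //.
      by exists 0; rewrite scale0r addr0.
    by left; rewrite subrr scaler0 addr0.
  rewrite joinedC_P // nearP //.
  have H : (forall p, ptC p -> near p <[u]>%VS -> near p <[v]>%VS -> near p <[w]>%VS) <->
     (forall s, affine s -> vnear s u -> vnear s v -> vnear s w).
    split=> [H s as0|H _ /ptCP[s [as0 sb ->]]]; last by rewrite !nearP //; apply: H.
    have /H : ptC <[s]>%VS by apply/ptCP; exists s; split=> //; apply: bA.
    by rewrite !nearP //; apply: bA.
  rewrite H; split=> [[[/(affine_line_inj au av)//]|[_ [[]//|[nuv]]]]|cw].
    by rewrite -col_of_double_near.
  right; split; first by move/(affine_line_inj au av).
  have [nuv|nuv] := classic (vnear u v); [right|left] => //.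
  by rewrite -col_of_double_near.
apply: (@definable_ext _ _ _ _ _ (fun e => (e x = e y /\ e z = e x) \/
    (~ e x = e y /\ (joined lnC (e x) (e y) (e z) \/ (near (e x) (e y) /\
     ((pole_line (e x) (e y) /\ pole_line (e x) (e z)) \/
      (~ pole_line (e x) (e y) /\ near (e z) (e x) /\ triangle (e x) (e y) (e z)))))))); last first.
  apply: definable_or; first by apply: definable_and; exact: definable_eq.
  apply: definable_and; first by apply: definable_not; exact: definable_eq.
  apply: definable_or; first exact: definable_joined.
  apply: definable_and; first exact: definable_near.
  apply: definable_or; first by apply: definable_and; exact: definable_pole_line.
  apply: definable_and; first by apply: definable_not; exact: definable_pole_line.
  apply: definable_and; first exact: definable_near.
  exact: definable_triangle.
move=> e pe; have [xy|xy] := classic (e x = e y).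
  rewrite -xy addvv; split=> [[[_ ->]|[]]|zx] //; left; split=> //.
  case: (pe z) (pe x) => /eqP pz _ _ [/eqP px _ _].
  by apply/eqP; rewrite eqEdim zx px pz.
have [plxy|plxy] := classic (pole_line (e x) (e y)).
  have [nxy xyE] := near_pole_line (pe x) (pe y) xy plxy.
  rewrite joined_col // xyE; split=> [[[]//|[_ [[]//|[_ [[]//|[]//]]]]]|zx].
  by right; split=> //; right; split=> //; left.
rewrite joined_col //; have [nxy|nxy] := classic (near (e x) (e y)).
  rewrite near_col_of_triangle //.
  split=> [[[]//|[_ [[]//|[_ [[]//|[_]]]]]]|zx] //.
  by right; split=> //; right; split=> //; right.
split=> [[[]//|[_ [[]//|[]//]]]|zx].
by right; split=> //; left.
Qed.

(** * Flats and directions of the affine space *)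

Definition ptA p := exists2 u, affine u & p = <[u]>%VS.

Definition flat (T : Type) (e : T -> {vspace V}) (s : seq T) := (\sum_(a <- s) e a)%VS.

Lemma flat_cons T (e : T -> {vspace V}) a s : flat e (a :: s) = (e a + flat e s)%VS.
Proof. by rewrite /flat big_cons. Qed.

Lemma flat_subP (T : eqType) (e : T -> {vspace V}) s W :
  (flat e s <= W)%VS <-> forall a, a \in s -> (e a <= W)%VS.
Proof.
elim: s => [|a s IH]; first by rewrite /flat big_nil sub0v.
rewrite flat_cons subv_add; split=> [/andP[aW /IH sW] c|aW].
  by rewrite inE => /predU1P[->|/sW].
rewrite aW ?inE ?eqxx //; apply/IH => c cs; apply: aW; by rewrite inE cs orbT.
Qed.

(** The meet with H is the point at infinity of the line through x and y, or empty
    if x = y. *)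
Definition direction_in x y W := ((x + y) :&: H <= W)%VS.

Lemma in_H u : (u \in H) = (xi u bv == 0).
Proof. by rewrite mem_orthov1. Qed.

Lemma direction_inP u v W : affine u -> affine v ->
  direction_in <[u]> <[v]> W <-> v - u \in W.
Proof.
move=> au av; split=> [/subvP dW|duW].
  apply: dW; rewrite memv_cap in_H formBl au av subrr eqxx andbT.
  by apply/add_in_line; exists (-1), 1; rewrite scale1r scaleN1r addrC.
apply/subvP => x /memv_capP[/add_in_line[a [c ->]]].
rewrite in_H !formE au av !mulr1 addr_eq0 => /eqP ->.
by rewrite scaleNr addrC -scalerBr memvZ.
Qed.

(** Induction step for spanning flats by lines.  Given p = a z + w with w in W, and
    k distinct from 0 and 1, the point r on the line x z is chosen so that k r has
    the same component a z; then p - k r lies in W and has weight 1 - k, hence is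
    a multiple of a point q of W. *)
Lemma flat_step W x z p : ptA x -> ptA z -> ptA p -> (x <= W)%VS ->
  (p <= z + W)%VS <->
  exists2 q, ptA q & (q <= W)%VS /\
    exists2 r, ptA r & (r <= x + z)%VS /\ (p <= q + r)%VS.
Proof.
move=> [u au ->] [v av ->] [w aw ->] uW; split; last first.
  move=> [q _ [qW [r _ [rW pqr]]]]; apply: subv_trans pqr _; rewrite subv_add.
  rewrite (subv_trans qW) ?addvSr //=; apply: subv_trans rW _.
  by rewrite subv_add addvSl (subv_trans uW) ?addvSr.
rewrite -memvE => /memv_addP[_ /vlineP[a ->] [w' w'W def_w]].
have [k] := outside (s := [:: 0; 1]) isT; rewrite !inE negb_or => /andP[k0 k1].
have k1' : 1 - k != 0 by rewrite subr_eq0 eq_sym.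
pose r := u + (a / k) *: (v - u); pose q := (1 - k)^-1 *: (w - k *: r).
have ar : affine r by rewrite /r /affine !formE au av; ring.
have aq : affine q by rewrite /q /affine !formE aw au av; field; rewrite ?k1' ?k0.
exists <[q]>%VS; first by exists q.
have def_q : q = (1 - k)^-1 *: (w' + (a - k) *: u).
  by apply: form_ext => s; rewrite /q /r def_w !formE; field; rewrite k1'.
rewrite -memvE in uW; split.
  by rewrite -memvE def_q memvZ // memvD // memvZ.
exists <[r]>%VS; first by exists r.
rewrite -!memvE -(affine_colP au av ar) -(affine_colP aq ar aw); split; first by exists (a / k).
by exists k; apply: form_ext => s; rewrite /q !formE; field; rewrite ?k1' ?k0.
Qed.

(** Two lines of a plane are parallel when they do not meet or are equal; the
    second condition covers both possibilities. *)
Lemma direction_in_line x y a c : ptA x -> ptA y -> ptA a -> ptA c ->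
  direction_in x y (a + c) <-> (y <= x + (a + c))%VS /\
  forall p, ptA p -> (p <= x + y)%VS -> (p <= a + c)%VS ->
    (x <= a + c)%VS /\ (y <= a + c)%VS.
Proof.
move=> [u au ->] [v av ->] [w aw ->] [w' aw' ->].
rewrite direction_inP // -!memvE; set W := (<[w]> + <[w']>)%VS; split=> [duW|].
  have def_v : v = u + (v - u) by rewrite addrC subrK.
  split; first by rewrite def_v memv_add ?memv_line.
  move=> _ [p ap ->]; rewrite -!memvE -(affine_colP au av ap) => -[t ->] pW.
  have uW : u \in W by rewrite -[u](addrK (t *: (v - u))) memvB // memvZ.
  by split=> //; rewrite def_v memvD.
case=> /memv_addP[_ /vlineP[k ->] [d dW def_v]] Hp.
have dv : xi d bv = 1 - k.
  by move: av; rewrite /affine def_v !formE au mulr1 => <-; rewrite addrC addKr.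
have [k1|k1] := eqVneq k 1; first by rewrite def_v k1 scale1r addrC addKr.
have k1' : 1 - k != 0 by rewrite subr_eq0 eq_sym.
pose p := (1 - k)^-1 *: d.
have pW : p \in W by rewrite memvZ.
have ap : affine p by rewrite /p /affine formZl dv mulVf.
have [|||uW vW] := Hp <[p]>%VS; rewrite -?memvE //; first by exists p.
  rewrite -(affine_colP au av ap); exists ((1 - k)^-1).
  by apply: form_ext => s; rewrite /p def_v !formE; field; rewrite ?k1' ?k1.
by rewrite memvB.
Qed.

(** The witness is the fourth vertex of the parallelogram on x, y and a. *)
Lemma direction_in_flat x y a W : ptA x -> ptA y -> ptA a -> (a <= W)%VS ->
  direction_in x y W <->
  exists2 p, ptA p & (p <= W)%VS /\ direction_in x y (a + p).
Proof.
move=> [u au ->] [v av ->] [w aw ->] wW; rewrite direction_inP //; split=> [duW|].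
  rewrite -memvE in wW.
  have ap : affine (w + (v - u)) by rewrite /affine !formE au av aw; ring.
  exists <[w + (v - u)]>%VS; first by exists (w + (v - u)).
  rewrite -memvE memvD // direction_inP //; split=> //.
  by apply/add_in_line; exists (-1), 1; rewrite scale1r scaleN1r addKr.
case=> _ [p ap ->] [pW]; rewrite direction_inP // => dW.
by apply: subvP dW; rewrite subv_add wW.
Qed.

(** The trace on H of the span of points e c is generated by the directions from
    a fixed one of them: projecting onto H along e a sends e c to the direction
    of the line through e a and e c. *)
Lemma flat_cap_H (T : eqType) (e : T -> {vspace V}) a s W : (forall c, ptA (e c)) ->
  (flat e (a :: s) :&: H <= W)%VS <->
  forall c, c \in a :: s -> direction_in (e a) (e c) W.
Proof.
move=> pe; split=> [sW c cs|HW].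
  apply: subv_trans sW; apply: capvS => //.
  have /(flat_subP e (a :: s)) sub := subvv (flat e (a :: s)).
  by rewrite subv_add !sub // inE eqxx.
have [u au def_a] := pe a.
suff dec x : x \in flat e (a :: s) -> x - xi x bv *: u \in W.
  apply/subvP => x /memv_capP[/dec]; rewrite in_H => xW /eqP x0.
  by move: xW; rewrite x0 scale0r subr0.
elim: {s}(a :: s) x HW => [|c s IH] x HW.
  by rewrite /flat big_nil memv0 => /eqP->; rewrite linear0l scale0r subr0 mem0v.
rewrite flat_cons; have [v av def_c] := pe c; rewrite def_c.
move=> /memv_addP[_ /vlineP[k ->] [y ys ->]].
have -> : k *: v + y - xi (k *: v + y) bv *: u = k *: (v - u) + (y - xi y bv *: u).
  by apply: form_ext => z; rewrite !formE av; ring.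
apply: memvD; last by apply: IH ys => c' c's; apply: HW; rewrite inE c's orbT.
apply: memvZ; rewrite -direction_inP // -def_a -def_c; apply: HW.
by rewrite inE eqxx.
Qed.

(** * Spanning by points of C1 *)

Lemma affine_ex : exists u, affine u.
Proof.
have bv0 : bv != 0 by move: b_point; rewrite /is_point dim_vline; case: (bv != 0).
have fr : free [:: bv] by rewrite seq1_free.
by have [u uP] := prescribed_values [:: 1] xi_nd fr; exists u; apply: (uP 0%N).
Qed.

Lemma H_vector (L : {vspace V}) : (2 <= \dim L)%N -> exists d, [/\ d != 0, d \in L & xi d bv = 0].
Proof.
move=> dL; have := leq_dim_orthov1 xi bv L; set U := (L :&: H)%VS => dU.
have : vpick U \in U by apply: memv_pick.
rewrite memv_cap in_H => /andP[dL' /eqP db]; exists (vpick U); split=> //.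
rewrite vpick0 -dimv_eq0 -lt0n; apply: leq_trans dU; by case: (\dim L) dL => [|[]].
Qed.

Lemma affine_shift u d : affine u -> xi d bv = 0 -> affine (u + d).
Proof. by move=> au db; rewrite /affine formDl au db addr0. Qed.

(** If b is on H any affine vector will do.  Otherwise translating bv by a
    suitable multiple of d avoids b; the other vectors of the
    family are no multiples of d, so they cannot lead back to b. *)
Lemma base_point (d : V) (ds : seq V) : free (d :: ds) ->
  (forall x, x \in d :: ds -> xi x bv = 0) ->
  exists u, [/\ affine u, u <> bv & forall x, x \in d :: ds -> u + x <> bv].
Proof.
move=> fr dsH; have [b1|nb] := classic (affine bv); last first.
  have [u au] := affine_ex; have nbA w : affine w -> w <> bv.
    by move=> aw wb; apply: nb; move: aw; rewrite wb.
  by exists u; split=> // [|x /dsH xH]; apply: nbA => //; apply: affine_shift.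
have [t] := outside (s := [:: 0; -1]) isT; rewrite !inE negb_or => /andP[t0 t1].
move: (fr); rewrite free_cons => /andP[dnds frds].
have d0 : d != 0 by have := free_not0 fr; apply; rewrite inE eqxx.
exists (bv + t *: d); split.
- by apply: affine_shift; rewrite // formZl dsH ?mulr0 ?inE ?eqxx.
- move=> h; have /eqP : t *: d = 0 by apply: (addrI bv); rewrite h addr0.
  by rewrite scaler_eq0 (negPf t0) (negPf d0).
move=> x xds h.
have tdx : t *: d + x = 0 by apply: (addrI bv); rewrite addrA h addr0.
move: xds tdx {h}; rewrite inE => /predU1P[->|xds] tdx.
  move/eqP: tdx; rewrite -[X in _ + X]scale1r -scalerDl scaler_eq0 (negPf d0) orbF.
  by rewrite addr_eq0 (negPf t1).
have dx : d = - t^-1 *: x.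
  have -> : x = - (t *: d) by apply/eqP; rewrite -addr_eq0 addrC tdx.
  by rewrite scalerN scaleNr opprK scalerA mulVf // scale1r.
by move/negP: dnds; apply; rewrite dx memvZ // memv_span.
Qed.

Definition frame (vs : seq V) := free vs /\ forall u, u \in vs -> affine u /\ u <> bv.

Lemma frame_at_infinity (ds : seq V) : free ds -> ds <> [::] ->
  (<<ds>> <= H)%VS -> exists2 vs, frame vs &
    size vs = (size ds).+1 /\ (<<vs>> :&: H)%VS = <<ds>>%VS.
Proof.
case: ds => [|d ds] // fr _ dsH.
have inH x : x \in d :: ds -> xi x bv = 0.
  by move=> xds; apply/eqP; rewrite -in_H; apply: (subvP dsH); apply: memv_span.
have [u [au ub uxb]] := base_point fr inH.
pose vs := u :: map (+%R u) (d :: ds).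
have uvs : u \in <<vs>>%VS by rewrite memv_span ?inE ?eqxx.
have dsvs : (<<d :: ds>> <= <<vs>>)%VS.
  apply/span_subvP => x xds; rewrite -[x](addKr u) addrC memvB // memv_span //.
  by rewrite inE map_f ?orbT.
have vsE : <<vs>>%VS = (<[u]> + <<d :: ds>>)%VS.
  apply/eqP; rewrite eqEsubv; apply/andP; split; last by rewrite subv_add -memvE uvs.
  apply/span_subvP => x.
  rewrite inE => /predU1P[->|/mapP[y yds ->]]; first by rewrite memvE addvSl.
  by rewrite memv_add ?memv_line // memv_span.
have frvs : free vs.
  have fr' : free (u :: d :: ds).
    rewrite free_cons fr andbT; apply/negP => uds.
    by have := subvP dsH u uds; rewrite in_H au oner_eq0.
  by rewrite /free vsE -span_cons (eqP fr') /= size_map.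
exists vs; last split.
- split=> // x; rewrite inE => /predU1P[->//|/mapP[y yds ->]].
  by split; [apply: affine_shift => //; apply: inH | apply: uxb].
- by rewrite /= size_map.
apply/esym/eqP; rewrite eqEdim subv_cap dsvs dsH /=.
rewrite -eq_dim_orthov1.
  by rewrite (eqP frvs) (eqP fr) /= size_map.
apply/negP => /mem_orthovP/(_ u uvs)/eqP; by rewrite form_sym au oner_eq0.
Qed.

Lemma frame_of_line L : is_line L -> ~ (L <= H)%VS ->
  exists2 vs, frame vs & size vs = 2%N /\ <<vs>>%VS = L.
Proof.
move=> lL /negP/subvPn[w' w'L]; rewrite in_H => w'b.
pose w := (xi w' bv)^-1 *: w'.
have aw : affine w by rewrite /w /affine formZl mulVf.
have wL : w \in L by rewrite memvZ.
have [|d [d0 dL db]] := H_vector (L := L); first by rewrite (eqP lL).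
have two u v : affine u -> affine v -> u <> v -> u <> bv -> v <> bv ->
    u \in L -> v \in L -> exists2 vs, frame vs & size vs = 2%N /\ <<vs>>%VS = L.
  move=> au av uv ub vb uL vL; exists [:: u; v].
    split; last by move=> x; rewrite !inE => /orP[/eqP->|/eqP->].
    rewrite free_cons seq1_free span_seq1 (affine_neq0 av) andbT.
    by apply/vlineP => -[k /(affine_eq au av)].
  by rewrite span_cons span_seq1 -(line_of_two lL au av uv).
have shift u s s' : s != s' -> u + s *: d <> u + s' *: d.
  move=> ss' /addrI/eqP; rewrite -subr_eq0 -scalerBl scaler_eq0 subr_eq0.
  by rewrite (negPf ss') (negPf d0).
have affZ u s : affine u -> affine (u + s *: d).
  by move=> au; apply: affine_shift; rewrite // formZl db mulr0.
have [[b1 bL]|nb] := classic (affine bv /\ bv \in L).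
  have [t] := outside (s := [:: 0; 1]) isT; rewrite !inE negb_or => /andP[t0 t1].
  have bE : bv = bv + 0 *: d by rewrite scale0r addr0.
  apply: (two (bv + 1 *: d) (bv + t *: d)); try exact: affZ.
  - by apply: shift; rewrite eq_sym.
  - by rewrite {2}bE; apply: shift; rewrite oner_eq0.
  - by rewrite {2}bE; apply: shift.
  - by rewrite memvD // memvZ.
  - by rewrite memvD // memvZ.
have nbA u : affine u -> u \in L -> u <> bv.
  by move=> au uL ub; apply: nb; move: au uL; rewrite ub.
have aw1 := affZ w 1 aw; have w1L : w + 1 *: d \in L by rewrite memvD // memvZ.
apply: (two w (w + 1 *: d)) => //; try exact: nbA.
by rewrite -{1}[w]addr0 -{1}(scale0r d); apply: shift; rewrite eq_sym oner_eq0.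
Qed.

Lemma ptC_ex : exists p, ptC p.
Proof.
have [d [d0 _ db]] := H_vector dimV.
have [|x|u [au ub _]] := base_point (d := d) (ds := [::]); first by rewrite seq1_free.
  by rewrite inE => /eqP->.
by exists <[u]>%VS; apply/ptCP; exists u.
Qed.

(** * Definability over the affine points *)

Definition put_b X (B : X -> bool) (e : X -> {vspace V}) x := if B x then b else e x.

(** If b is off H it is an affine point but not a point of C1.  Requiring that a
    relation stays definable from C1 after substituting b for any set of variables
    makes it possible to quantify over all affine points ([adef_ex]). *)
Definition affine_definable X (R : (X -> {vspace V}) -> Prop) :=
  forall B : X -> bool, (forall x, B x -> affine bv) ->
  definableC (fun e => R (put_b B e)).

Lemma ptC_ptA p : ptC p -> ptA p.
Proof. by move=> /ptCP[u [au _ ->]]; exists u. Qed.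

Lemma ptA_put X (B : X -> bool) e : (forall x, B x -> affine bv) ->
  (forall x, ptC (e x)) -> forall x, ptA (put_b B e x).
Proof.
move=> bA pe x; rewrite /put_b; case: (boolP (B x)) => [/bA b1|_]; first by exists bv.
exact: ptC_ptA.
Qed.

Lemma adef_ext X (R R' : (X -> {vspace V}) -> Prop) :
  (forall e, (forall x, ptA (e x)) -> R e <-> R' e) ->
  affine_definable R -> affine_definable R'.
Proof.
move=> RR' dR B bA; apply: definable_ext (dR B bA) => e pe; apply: RR'.
exact: ptA_put.
Qed.

Lemma adef_and X (R R' : (X -> {vspace V}) -> Prop) :
  affine_definable R -> affine_definable R' ->
  affine_definable (fun e => R e /\ R' e).
Proof. by move=> dR dR' B bA; apply: definable_and; [apply: dR|apply: dR']. Qed.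

Lemma adef_imp X (R R' : (X -> {vspace V}) -> Prop) :
  affine_definable R -> affine_definable R' ->
  affine_definable (fun e => R e -> R' e).
Proof. by move=> dR dR' B bA; apply: definable_imp; [apply: dR|apply: dR']. Qed.

Lemma adef_not X (R : (X -> {vspace V}) -> Prop) :
  affine_definable R -> affine_definable (fun e => ~ R e).
Proof. by move=> dR B bA; apply: definable_not; apply: dR. Qed.

Lemma adef_const X (P : Prop) : affine_definable (fun _ : X -> _ => P).
Proof. by move=> B bA; apply: definable_const. Qed.

Lemma adef_all_in X (T : eqType) (s : seq T) (R : T -> (X -> {vspace V}) -> Prop) :
  (forall a, affine_definable (R a)) ->
  affine_definable (fun e => forall a, a \in s -> R a e).
Proof.
move=> dR B bA; apply: (@definable_all_in _ _ _ _ _ _ s (fun a e => R a (put_b B e))).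
by move=> a; apply: dR.
Qed.

Lemma adef_ex X (R : {vspace V} -> (X -> {vspace V}) -> Prop) :
  affine_definable (fun e : option X -> _ => R (e None) (fun x => e (Some x))) ->
  affine_definable (fun e => exists2 p, ptA p & R p e).
Proof.
move=> dR B bA; pose B' c (x : option X) := if x is Some x' then B x' else c.
have dF := dR (B' false); have dT := dR (B' true).
have [b1|nb1] := classic (affine bv).
  have {}dF : definableC (fun e => exists2 p, ptC p & R p (put_b B e)).
    by apply: (definable_ex (R := fun p e => R p (put_b B e))); apply: dF => -[].
  (* R b does not depend on p, which only binds the additional variable *)
  have {}dT : definableC (fun e => exists2 p, ptC p & R b (put_b B e)).
    by apply: (definable_ex (R := fun p e => R b (put_b B e))); apply: dT => -[].
  apply: definable_ext (definable_or dF dT) => e pe; split.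
    case=> [[p pp Rp]|[p _ Rb]]; first by exists p => //; apply: ptC_ptA.
    by exists b => //; exists bv.
  case=> _ [u au ->] Ru; have [ub|ub] := classic (u = bv).
    by right; have [p pp] := ptC_ex; exists p; rewrite // -ub.
  by left; exists <[u]>%VS => //; apply/ptCP; exists u.
have {}dF : definableC (fun e => exists2 p, ptC p & R p (put_b B e)).
  by apply: (definable_ex (R := fun p e => R p (put_b B e))); apply: dF => -[x /bA|].
apply: definable_ext dF => e pe; split=> -[p pp Rp].
  by exists p => //; apply: ptC_ptA.
exists p => //; case: pp => u au ->; apply/ptCP; exists u; split=> //.
by move=> ub; apply: nb1; move: au; rewrite ub.
Qed.

Lemma adef_all X (R : {vspace V} -> (X -> {vspace V}) -> Prop) :
  affine_definable (fun e : option X -> _ => R (e None) (fun x => e (Some x))) ->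
  affine_definable (fun e => forall p, ptA p -> R p e).
Proof.
move=> /adef_not/(adef_ex (R := fun p e => ~ R p e))/adef_not; apply: adef_ext => e _.
by split=> [h p pp|h [p pp]]; [apply: NNPP => nR; apply: h; exists p | apply; apply: h].
Qed.

Lemma pole_between p q : ptC p -> ptC q ->
  (b <= p + q)%VS <-> p <> q /\ pole_line p q.
Proof.
move=> pp pq; split=> [bpq|[pq' plpq]].
  have p_q : p <> q.
    move=> p_q; case: pp => /eqP dp _; apply; apply/eqP.
    by rewrite eq_sym eqEdim -[X in (_ <= X)%VS]addvv {2}p_q bpq dp (eqP b_point).
  split=> //; rewrite /pole_line; move: (pp) (pq) => /ptCP[u [au ub def_p]].
  case/ptCP => v [av _ def_q].
  suff <- : (p + q = b + p)%VS by rewrite addvSr.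
  have uv : u <> v by move=> uv; apply: p_q; rewrite def_p def_q uv.
  apply/esym/eqP; rewrite eqEdim subv_add bpq addvSl /= def_p def_q.
  rewrite (eqP (affine_line au av uv)).
  have : free [:: bv; u].
    rewrite free_cons seq1_free (affine_neq0 au) span_seq1 andbT.
    have [_ _ pb] := pp; apply/negP => bu; apply: pb; apply/esym/eqP.
    by rewrite eqEdim def_p -memvE bu (eqP b_point) (eqP (affine_point au)).
  by rewrite /free span_cons span_seq1 => /eqP ->.
by rewrite (near_pole_line pp pq pq' plpq).2 addvSl.
Qed.

Lemma adef_col X (x y z : X) : affine_definable (fun e => (e z <= e x + e y)%VS).
Proof.
move=> B bA; rewrite /put_b.
have b1 w : B w -> affine bv := bA w.
have dcol := definable_col.
have dpl u v (h : affine bv) := definable_pole_line u v h.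
case: (boolP (B z)) => [/b1 h|_]; case: (boolP (B x)) => [/b1 h'|_];
  case: (boolP (B y)) => [/b1 h''|_].
- by apply: definable_ext (definable_const _ _ _ True) => e _; rewrite addvSl.
- by apply: definable_ext (definable_const _ _ _ True) => e _; rewrite addvSl.
- by apply: definable_ext (definable_const _ _ _ True) => e _; rewrite addvSr.
- apply: (@definable_ext _ _ _ _ _ (fun e => ~ e x = e y /\ pole_line (e x) (e y))).
    by move=> e pe; rewrite (pole_between (pe x) (pe y)).
  apply: definable_and; last exact: dpl.
  by apply: definable_not; apply: definable_eq.
- apply: definable_ext (definable_const _ _ _ False) => e pe; split=> //.
  rewrite addvv; case: (pe z) => /eqP pz _ zb zb'; apply: zb; apply/eqP.
  by rewrite eqEdim zb' pz (eqP b_point).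
- exact: dpl.
- by apply: definable_ext (dpl _ x z _) => // e _; rewrite addvC.
- exact: dcol.
Qed.

(** The map f absorbs the variables that the quantifiers of [flat_step] add. *)
Lemma adef_in_flat X Y (f : X -> Y) (x : Y) (s : seq X) :
  affine_definable (fun e => (e x <= flat (fun a => e (f a)) s)%VS).
Proof.
case: s => [|y s].
  apply: adef_ext (@adef_const _ False) => e pe; split=> //.
  case: (pe x) => u au ->; rewrite /flat big_nil -memvE memv0 => /eqP u0.
  by move: (affine_neq0 au); rewrite u0 eqxx.
elim: s Y f x y => [|z s IH] Y f x y.
  apply: adef_ext (adef_col (f y) (f y) x) => e pe.
  by rewrite flat_cons /flat big_nil addv0 addvv.
pose W (e : Y -> {vspace V}) := flat (fun a => e (f a)) (z :: s).
pose R (q r : {vspace V}) (e : Y -> {vspace V}) :=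
  (r <= e (f z) + e (f y))%VS /\ (e x <= q + r)%VS.
apply: (@adef_ext _ (fun e => exists2 q, ptA q & (q <= W e)%VS /\ exists2 r, ptA r & R q r e)).
  move=> e pe; rewrite flat_cons -flat_step //.
  by rewrite /W flat_cons addvSl.
apply: (@adef_ex _ (fun q e => (q <= W e)%VS /\ exists2 r, ptA r & R q r e)).
apply: adef_and; first exact: (IH _ (fun a => Some (f a)) None z).
apply: (@adef_ex _ (fun r e => R (e None) r (fun x => e (Some x)))).
by apply: adef_and; apply: adef_col.
Qed.

Lemma adef_direction_line X (x y a c : X) :
  affine_definable (fun e => direction_in (e x) (e y) (e a + e c)).
Proof.
apply: adef_ext (fun e pe => iff_sym (direction_in_line (pe x) (pe y) (pe a) (pe c))) _.
apply: adef_and.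
  apply: adef_ext (adef_in_flat id y [:: x; a; c]) => e _.
  by rewrite !flat_cons /flat big_nil addv0.
apply: adef_all; do 2![apply: adef_imp; first exact: adef_col].
by apply: adef_and; apply: adef_col.
Qed.

Lemma adef_direction_flat X (x y : X) a s :
  affine_definable (fun e => direction_in (e x) (e y) (flat e (a :: s))).
Proof.
apply: (@adef_ext _ (fun e => exists2 p, ptA p &
    (p <= flat e (a :: s))%VS /\ direction_in (e x) (e y) (e a + p))).
  move=> e pe; rewrite -direction_in_flat //.
  by rewrite flat_cons addvSl.
apply: (@adef_ex _ (fun p e => (p <= flat e (a :: s))%VS /\ direction_in (e x) (e y) (e a + p))).
apply: adef_and; last exact: adef_direction_line.
exact: (adef_in_flat Some None (a :: s)).
Qed.

(** With h the part at infinity of the flat, which is how subspaces of H are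
    reached from points off H. *)
Definition span_or_trace (T : Type) (h : bool) (e : T -> {vspace V}) (s : seq T) :=
  if h then (flat e s :&: H)%VS else flat e s.

(** A flat spanned by points off H is never contained in H; a trace is contained in
    W as soon as the directions generating it are. *)
Lemma adef_le (X : eqType) h h' (x : X) s y r :
  affine_definable (fun e =>
    (span_or_trace h e (x :: s) <= span_or_trace h' e (y :: r))%VS).
Proof.
case: h => /=.
  apply: (@adef_ext _ (fun e => forall c, c \in x :: s ->
      direction_in (e x) (e c) (flat e (y :: r)))).
    move=> e pe; rewrite -flat_cap_H //; case: h' => //=.
    by rewrite subv_cap capvSr andbT.
  by apply: adef_all_in => c; apply: adef_direction_flat.
case: h' => /=.
  apply: adef_ext (@adef_const _ False) => e pe; split=> //.
  rewrite flat_cons => xH; case: (pe x) => u au def_x.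
  have : u \in H.
    apply: (subvP (subv_trans xH (capvSr _ _))); apply: (subvP (addvSl _ _)).
    by rewrite def_x memv_line.
  by rewrite in_H au oner_eq0.
apply: adef_ext (fun e pe => iff_sym (flat_subP e (x :: s) _)) _.
by apply: adef_all_in => c; apply: (adef_in_flat id).
Qed.

(** * Points and lines of the projective space as tuples *)

Definition b_affine := xi bv bv == 1.

(** [Some (h, l)] codes points if l is false and lines if l is true; they are
    contained in H if h is true, and then spanned by one point more before
    intersecting with H.  [None] stands for b when b is off H; it is coded by an
    arbitrary point of C1, for which b is substituted. *)
Definition kind := {i : option (bool * bool) | (i == None) ==> b_affine}.

Definition is_b (i : kind) := val i == None.
Definition at_infinity (i : kind) := (odflt (false, false) (val i)).1.
Definition lineal (i : kind) := (odflt (false, false) (val i)).2.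
Definition len (i : kind) := (lineal i + at_infinity i).+1.

Definition rep (i : kind) (t : 'I_(len i) -> {vspace V}) : {vspace V} :=
  span_or_trace (at_infinity i) (put_b (fun=> is_b i) t) (enum 'I_(len i)).

Arguments rep : clear implicits.

Fixpoint independent (T : Type) (e : T -> {vspace V}) (s : seq T) : Prop :=
  if s is a :: s' then ~ (e a <= flat e s')%VS /\ independent e s' else True.

Lemma independent_dim T (e : T -> {vspace V}) s : (forall a, ptA (e a)) ->
  independent e s -> \dim (flat e s) = size s.
Proof.
move=> pe; elim: s => [|a s IH] /=; first by rewrite /flat big_nil dimv0.
move=> [na /IH ds]; rewrite flat_cons dimv_disjoint_sum; last first.
  have [u au def_a] := pe a; apply/eqP; rewrite -subv0; apply/subvP => x.
  rewrite memv_cap def_a => /andP[/vlineP[k ->]].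
  have [->|k0] := eqVneq k 0; first by move=> _; rewrite scale0r mem0v.
  move=> kus; case: na; rewrite def_a -memvE.
  by rewrite -[u](scalerK k0) memvZ.
by have [u au ->] := pe a; rewrite dim_vline (affine_neq0 au) ds add1n.
Qed.

Lemma adef_independent X (s : seq X) :
  affine_definable (fun e => independent e s).
Proof.
elim: s => [|a s IH] /=; first exact: adef_const.
apply: adef_and IH; apply: adef_not.
exact: (adef_in_flat id).
Qed.

Definition based (i : kind) t :=
  (forall a, ptC (t a)) /\ independent (put_b (fun=> is_b i) t) (enum 'I_(len i)).

Arguments based : clear implicits.

Lemma is_b_affine i : is_b i -> affine bv.
Proof. by case: i => -[i|] /= bi // _; apply/eqP. Qed.

(** In the case of a trace the intersection with the hyperplane H lowers the
    dimension by one. *)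
Lemma rep_dim i t : based i t -> \dim (rep i t) = (lineal i).+1.
Proof.
move=> [pt ind]; have pA := ptA_put (fun _ => @is_b_affine i) pt.
have dF := independent_dim pA ind.
rewrite /rep /span_or_trace; case hi : (at_infinity i).
  rewrite -eq_dim_orthov1; first by rewrite dF size_enum_ord /len hi addn1.
  have [u au def_u] := pA ord0.
  have uF : u \in flat (put_b (fun=> is_b i) t) (enum 'I_(len i)).
    by rewrite enum_ordSl flat_cons memvE -def_u addvSl.
  by apply/negP => /mem_orthovP/(_ u uF)/eqP; rewrite form_sym au oner_eq0.
by rewrite dF size_enum_ord /len hi addn0.
Qed.

Lemma rep_frame i vs : is_b i = false -> frame vs -> size vs = len i ->
  exists t, based i t /\
    rep i t = if at_infinity i then (<<vs>> :&: H)%VS else <<vs>>%VS.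
Proof.
move=> nb [fr vsA] svs; pose t (a : 'I_(len i)) := <[vs`_a]>%VS.
have tE : put_b (fun=> is_b i) t = t.
  by apply: functional_extensionality => a; rewrite /put_b nb.
have flatE s : flat t s = <<[seq vs`_(val a) | a <- s]>>%VS.
  elim: s => [|a s IH]; first by rewrite /flat big_nil span_nil.
  by rewrite flat_cons IH /= span_cons.
have vsE : [seq vs`_(val a) | a <- enum 'I_(len i)] = vs.
  transitivity (map (nth 0 vs) (map val (enum 'I_(len i)))); first by rewrite -map_comp.
  by rewrite val_enum_ord -svs -/(mkseq _ _) mkseq_nth.
exists t; split; last by rewrite /rep tE /span_or_trace flatE vsE.
split=> [a|].
  have [au ub] : affine vs`_a /\ vs`_a <> bv by apply: vsA; rewrite mem_nth ?svs.
  by apply/ptCP; exists vs`_a.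
rewrite tE; move: fr; rewrite -vsE; elim: (enum _) => //= a s IH.
by rewrite free_cons => /andP[/negP an /IH]; rewrite flatE -memvE.
Qed.

Definition mk_kind h l : kind := exist (fun i => (i == None) ==> b_affine) (Some (h, l)) isT.

Lemma rep_onto y : is_point y \/ is_line y -> exists i t, based i t /\ rep i t = y.
Proof.
move=> yP; have [yH|yH] := boolP (y <= H)%VS.
  have [l dy] : exists l : bool, \dim y = l.+1.
    by case: yP => /eqP->; [exists false|exists true].
  have y_b := vbasisP y; have fr := basis_free y_b.
  have ds0 : tval (vbasis y) <> [::].
    by move=> /(congr1 size); rewrite size_tuple dy.
  have spanE := span_basis y_b.
  have [|vs fvs [svs vsE]] := frame_at_infinity fr ds0; first by rewrite spanE.
  have [|t [bt rt]] := @rep_frame (mk_kind true l) vs erefl fvs.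
    by rewrite svs size_tuple dy /len addn1.
  by exists (mk_kind true l), t; split=> //; rewrite rt /= vsE spanE.
case: yP => [py|ly]; last first.
  have [|vs fvs [svs vsE]] := frame_of_line ly; first exact/negP.
  have [//|t [bt rt]] := @rep_frame (mk_kind false true) vs erefl fvs.
  by exists (mk_kind false true), t; split=> //; rewrite rt /= vsE.
have [u u0 def_y] := point_vector py.
have ub : xi u bv != 0 by move: yH; rewrite def_y -memvE in_H.
have [v av def_u] := affine_scale ub.
have [vb|vb] := classic (v = bv).
  have b1 : b_affine by apply/eqP; move: av; rewrite vb.
  have [p pp] := ptC_ex.
  pose i : kind := exist _ None b1.
  exists i, (fun=> p); rewrite /based /rep.
  have -> : put_b (fun=> is_b i) (fun _ : 'I_(len i) => p) = (fun=> b).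
    by apply: functional_extensionality.
  have -> : enum 'I_(len i) = [:: ord0] by rewrite enum_ordSl (size0nil (size_enum_ord 0)).
  rewrite /= /flat big_cons !big_nil addv0 def_y def_u vb; split=> //.
  split; [by [] | split=> //; rewrite -memvE memv0].
  by move/eqP=> b0; move: (affine_neq0 av); rewrite vb b0 eqxx.
have [||t [bt rt]] := @rep_frame (mk_kind false false) [:: v] erefl => //.
  by split; [rewrite seq1_free (affine_neq0 av) | move=> x; rewrite inE => /eqP->].
by exists (mk_kind false false), t; rewrite rt /= span_seq1 def_y def_u.
Qed.

(** * A criterion for definability from C1 *)

Lemma span_or_trace_map h (T X : Type) (f : T -> X) (e : X -> {vspace V}) s :
  span_or_trace h e (map f s) = span_or_trace h (fun a => e (f a)) s.
Proof. by rewrite /span_or_trace /flat big_map. Qed.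

Lemma definable_le (X : eqType) h h' (B : X -> bool) x s y r :
  (forall z, B z -> affine bv) ->
  definableC (fun e => (span_or_trace h (put_b B e) (x :: s)
    <= span_or_trace h' (put_b B e) (y :: r))%VS).
Proof.
by apply: (adef_le ).
Qed.

Lemma repE X (i : kind) (f : 'I_(len i) -> X) (B : X -> bool) e :
  (forall a, B (f a) = is_b i) ->
  rep i (fun a => e (f a)) = span_or_trace (at_infinity i) (put_b B e)
    (f ord0 :: map f (map (lift ord0) (enum 'I_(lineal i + at_infinity i)))).
Proof.
move=> Bf; rewrite -map_cons -enum_ordSl span_or_trace_map /rep; congr span_or_trace.
by apply: functional_extensionality => a; rewrite /put_b Bf.
Qed.

Lemma definable_rep_le (X : eqType) (i j : kind) (f : 'I_(len i) -> X)
    (g : 'I_(len j) -> X) (B : X -> bool) :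
  (forall a, B (f a) = is_b i) -> (forall a, B (g a) = is_b j) ->
  (forall x, B x -> affine bv) ->
  definableC (fun e => (rep i (fun a => e (f a)) <= rep j (fun a => e (g a)))%VS).
Proof.
move=> Bf Bg bA.
apply: definable_ext (definable_le (at_infinity i) (at_infinity j) (f ord0)
  (map f (map (lift ord0) (enum 'I_(lineal i + at_infinity i))))
  (g ord0) (map g (map (lift ord0) (enum 'I_(lineal j + at_infinity j)))) bA).
by move=> e pe; rewrite (repE e Bf) (repE e Bg).
Qed.

Lemma lnB_points L : lnB L -> exists u v,
  [/\ [/\ affine u, affine v & u <> v], u <> bv, v <> bv & L = (<[u]> + <[v]>)%VS].
Proof.
move=> [lL _ nH]; have [|vs [fr vsA] [svs vsE]] := frame_of_line lL.
  move=> LH; apply: nH => p pp pL; split=> //.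
  have [u u0 def_p] := point_vector pp.
  rewrite def_p /perp orthov11 xi_sq.
  have : u \in H by apply: (subvP (subv_trans pL LH)); rewrite def_p memv_line.
  by rewrite in_H => /eqP->; rewrite expr0n.
case: vs fr vsA svs vsE => [|u [|v [|]]] // fr vsA _ vsE.
have [au ub] : affine u /\ u <> bv by apply: vsA; rewrite !inE eqxx.
have [av vb] : affine v /\ v <> bv by apply: vsA; rewrite !inE eqxx orbT.
exists u, v; split=> //; last by rewrite -vsE span_cons span_seq1.
by split=> // uv; move: fr; rewrite uv free_cons span_seq1 memv_line.
Qed.

Lemma lnC_points L : lnC L -> exists u v,
  [/\ [/\ affine u, affine v & u <> v], u <> bv, v <> bv & L = (<[u]> + <[v]>)%VS].
Proof. by case=> lL rL nH _; apply: lnB_points. Qed.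

(** A line of C1 contains two points of C1, so inclusions that involve elements of
    C1 can be tested on points. *)
Lemma elt_sub x W : elt MC x ->
  (x <= W)%VS <-> forall p, ptC p -> (p = x \/ lnC x /\ (p <= x)%VS) -> (p <= W)%VS.
Proof.
case=> [px|lx]; split=> [xW p pp [->|[_ px']]|h] //; try exact: (subv_trans px' xW).
- by apply: h => //; left.
have [u [v [[au av uv] ub vb xE]]] := lnC_points lx.
rewrite xE subv_add; apply/andP; split; apply: h.
- by apply/ptCP; exists u.
- by right; split=> //; rewrite xE addvSl.
- by apply/ptCP; exists v.
- by right; split=> //; rewrite xE addvSr.
Qed.

Lemma sub_elt x W : elt MC x ->
  (W <= x)%VS <-> exists2 p, ptC p & (p = x \/ lnC x /\ (p <= x)%VS) /\
    exists2 q, ptC q & (q = x \/ lnC x /\ (q <= x)%VS) /\ (W <= p + q)%VS.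
Proof.
move=> Mx; split; last first.
  move=> [p _ [px [q _ [qx Wpq]]]]; apply: subv_trans Wpq _.
  by rewrite subv_add; case: px => [->|[_ ->]]; case: qx => [->|[_ ->]]; rewrite ?subvv.
case: Mx => [px|lx] Wx.
  by exists x => //; split; [left|exists x => //; split; [left|rewrite addvv]].
have [u [v [[au av uv] ub vb xE]]] := lnC_points lx.
exists <[u]>%VS; first by apply/ptCP; exists u.
split; first by right; split=> //; rewrite xE addvSl.
exists <[v]>%VS; first by apply/ptCP; exists v.
by split; [right; split=> //; rewrite xE addvSr | rewrite -xE].
Qed.

Definition FOn X (p x : X) : formula (sig MC) X := FOr (FEq _ p x) (FIn ptC lnC p x).

Lemma sat_on X (p x : X) e : ptC (e p) ->
  sat (FOn p x) e <-> (e p = e x \/ lnC (e x) /\ (e p <= e x)%VS).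
Proof. move=> pp; split=> /= [[px|[_ lx px]]|[px|[lx px]]]; by [left | right]. Qed.

Lemma all_points_formula n : exists phi : formula (sig MC) 'I_n,
  forall e, sat phi e <-> forall a, ptC (e a).
Proof.
have [phi phiP] : exists phi : formula (sig MC) 'I_n,
    forall e, sat phi e <-> forall a, a \in enum 'I_n -> ptC (e a).
  elim: (enum _) => [|a s [phi phiP]].
    by exists (FAll (FEq _ None None)) => e /=; split.
  exists (FAnd (FPoint ptC lnC a) phi) => e /=; rewrite phiP; split=> [[pa ps] c|h].
    by rewrite inE => /predU1P[->|/ps].
  by split=> [|c cs]; apply: h; rewrite inE ?eqxx ?cs ?orbT.
by exists phi => e; rewrite phiP; split=> h a; auto; apply: h; rewrite mem_enum.
Qed.

Section Substructure.

Variables ptN lnN : {vspace V} -> Prop.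
Hypothesis ptN_point : forall p, ptN p -> is_point p.
Hypothesis lnN_line : forall L, lnN L -> is_line L.
Local Notation N := (point_line_structure ptN lnN).
Hypothesis N_definable : forall i : kind,
  exists phi : formula (sig MC) 'I_(len i), forall t, based i t ->
    sat phi t <-> ptN (rep i t) \/ lnN (rep i t).

Definition valid (i : kind) t := based i t /\ (ptN (rep i t) \/ lnN (rep i t)).

Arguments valid i t : clear implicits.

Lemma dom_formula (i : kind) : exists phi : formula (sig MC) 'I_(len i),
  forall t, in_dom phi t <-> valid i t.
Proof.
have [phi phiP] := all_points_formula (len i).
have bA (x : 'I_(len i)) : is_b i -> affine bv by apply: is_b_affine.
have [psi psiP] := adef_independent
  (enum 'I_(len i)) bA.
have [del delP] := N_definable i.
exists (FAnd phi (FAnd psi del)) => t; rewrite /in_dom /=; split.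
  move=> [_ [/phiP pt []]]; rewrite psiP // => ind; rewrite delP; last by split.
  by split=> //; split.
move=> [[pt ind] Nt]; split; first by move=> a; left; apply: pt.
rewrite phiP psiP //; split=> //; split=> //; rewrite delP //; split=> //.
Qed.

Lemma valid_point (i : kind) t : valid i t -> ptN (rep i t) <-> lineal i = false.
Proof.
move=> [bt Nt]; have := rep_dim bt; case: Nt => Nt.
  by move: (ptN_point Nt) => /eqP->; case: (lineal i).
move: (lnN_line Nt) => /eqP dl; rewrite dl; case: (lineal i) => // _; split=> // /ptN_point.
by rewrite /is_point dl.
Qed.

Lemma valid_line (i : kind) t : valid i t -> lnN (rep i t) <-> lineal i = true.
Proof.
move=> [bt Nt]; have := rep_dim bt; case: Nt => Nt.
  move: (ptN_point Nt) => /eqP dl; rewrite dl; case: (lineal i) => // _; split=> // /lnN_line.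
  by rewrite /is_line dl.
by move: (lnN_line Nt) => /eqP->; case: (lineal i).
Qed.

(** Inclusions between represented subspaces give all the required formulas:
    equality is double inclusion, a kind decides between points and lines, and
    inclusions involving elements of C1 reduce to points by [elt_sub] and
    [sub_elt]. *)
Lemma definable_from_C : definable_in N MC.
Proof.
have domE := fun i => constructive_indefinite_description _ (dom_formula i).
pose dom i := proj1_sig (domE i).
have domP i t : in_dom (dom i) t <-> valid i t := proj2_sig (domE i) t.
have leE (i j : kind) : exists phi : formula (sig MC) ('I_(len i) + 'I_(len j)),
    forall t u, valid i t -> valid j u -> sat phi (sum_env t u) <-> (rep i t <= rep j u)%VS.
  pose B (x : 'I_(len i) + 'I_(len j)) := if x is inl _ then is_b i else is_b j.
  have [|||phi phiP] := @definable_rep_le _ i j inl inr B => //.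
    by case=> a; apply: is_b_affine.
  exists phi => t u [[pt _] _] [[pu _] _]; rewrite phiP //.
  by case.
have eqE (i j : kind) : exists phi : formula (sig MC) ('I_(len i) + 'I_(len j)),
    forall t u, valid i t -> valid j u -> sat phi (sum_env t u) <-> rep i t = rep j u.
  have [phi phiP] := leE i j; have [psi psiP] := leE j i.
  pose sw (x : 'I_(len j) + 'I_(len i)) := match x with inl a => inr a | inr a => inl a end.
  exists (FAnd phi (rename psi sw)) => t u vt vu /=; rewrite phiP // sat_rename.
  have -> : (fun x => sum_env t u (sw x)) = sum_env u t.
    by apply: functional_extensionality => -[].
  rewrite psiP //; split=> [[tu ut]|->]; last by rewrite subvv.
  by apply/eqP; rewrite eqEsubv tu.
pose eqF i j := proj1_sig (constructive_indefinite_description _ (eqE i j)).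
have eqP' i j t u : valid i t -> valid j u -> sat (eqF i j) (sum_env t u) <-> rep i t = rep j u.
  exact: (proj2_sig (constructive_indefinite_description _ (eqE i j))).
exists kind, len, dom, eqF, (fun i t => rep i t); split.
- split=> [i t /domP[]|y Ny] //.
  have [|i [t [bt rt]]] := rep_onto (y := y).
    by case: Ny => [/ptN_point|/lnN_line]; auto.
  by exists i, t; split=> //; apply/domP; split; rewrite ?rt.
- by move=> i j t u /domP vt /domP vu; apply: eqP'.
- case=> c.
  + exists (if lineal (c ord0) then FNot (FAll (FEq _ None None)) else FAll (FEq _ None None)).
    move=> t tP; have /domP vt := tP ord0; rewrite /= (valid_point vt).
    by case: (lineal _) => /=; split=> // h; case: h.
  + exists (if lineal (c ord0) then FAll (FEq _ None None) else FNot (FAll (FEq _ None None))).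
    move=> t tP; have /domP vt := tP ord0; rewrite /= (valid_line vt).
    by case: (lineal _) => /=; split=> // h; case: h.
  pose X : eqType := {a : 'I_2 & 'I_(len (c a))}.
  pose B (x : X) := is_b (c (tag x)).
  pose inj a (x : 'I_(len (c a))) : X := Tagged (fun a => 'I_(len (c a))) x.
  have [|||phi phiP] := @definable_rep_le X (c ord0) (c ord_max) (@inj ord0) (@inj ord_max) B => //.
    by move=> x; apply: is_b_affine.
  exists (if ~~ lineal (c ord0) && lineal (c ord_max) then phi else FNot (FAll (FEq _ None None))).
  move=> t tP; have /domP vt := tP ord0; have /domP vu := tP ord_max.
  have hp := valid_point vt; have hl := valid_line vu.
  case: (lineal (c ord0)) hp => hp /=.
    by split=> [h|[/hp]//]; case: h.
  case: (lineal (c ord_max)) hl => hl /=; last first.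
    by split=> [h|[_ /hl]//]; case: h.
  rewrite phiP /=; last by move=> [a x]; case/domP: (tP a) => -[pt _] _; exact: pt.
  by split=> [tu|[]//]; split=> //; [apply/hp | apply/hl].
- move=> i; pose B (x : option 'I_(len i)) := if x is Some _ then is_b i else false.
  have [|psi psiP] := @definable_le (option 'I_(len i)) false (at_infinity i) B None [::]
     (Some ord0) (map Some (map (lift ord0) (enum 'I_(lineal i + at_infinity i)))).
    by case=> // a; apply: is_b_affine.
  exists (FAll (FImp (FAnd (FPoint ptC lnC None) (FOn None (Some None)))
     (rename psi (fun x => if x is Some a then Some (Some a) else None)))).
  move=> x t Mx /domP vt; rewrite elt_sub //.
  have E p : ptC p -> sat (rename psi (fun x => if x is Some a then Some (Some a) else None))
      (bind_var p (bind_var x t)) <-> (p <= rep i t)%VS.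
    move=> pp; rewrite sat_rename.
    have -> : (fun x0 : option 'I_(len i) => bind_var p (bind_var x t)
       (if x0 is Some a then Some (Some a) else None)) = bind_var p t.
      by apply: functional_extensionality => -[].
    rewrite psiP; last by case=> // a; case: vt => -[pt _] _; exact: pt.
    rewrite -(@repE _ i Some B (bind_var p t)) // /span_or_trace /flat big_seq1.
    by [].
  rewrite sat_all_imp; split=> [h p pp px|h p Mp [pp pon]].
    by rewrite -E //; apply: h; [left | split=> //; apply/sat_on].
  rewrite E //; apply: h => //.
  exact: (@sat_on _ None (Some None) (bind_var p (bind_var x t)) pp).1 pon.
move=> i; pose X := option (option 'I_(len i)).
pose B (x : X) := if x is Some (Some _) then is_b i else false.
have [|psi psiP] := @definable_le X (at_infinity i) false B (Some (Some ord0))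
   (map (fun a => Some (Some a)) (map (lift ord0) (enum 'I_(lineal i + at_infinity i)))) (Some None) [:: None].
  by case=> // -[] // a; apply: is_b_affine.
pose h (x : X) : option (option (option 'I_(len i))) :=
  match x with None => None | Some None => Some None | Some (Some a) => Some (Some (Some a)) end.
exists (FEx (FAnd (FPoint ptC lnC None) (FAnd (FOn None (Some None))
   (FEx (FAnd (FPoint ptC lnC None) (FAnd (FOn None (Some (Some None))) (rename psi h))))))).
move=> x t Mx /domP vt; rewrite sub_elt //.
have E p q : ptC p -> ptC q -> sat (rename psi h) (bind_var q (bind_var p (bind_var x t))) <->
    (rep i t <= p + q)%VS.
  move=> pp pq; rewrite sat_rename.
  have -> : (fun y => bind_var q (bind_var p (bind_var x t)) (h y)) = bind_var q (bind_var p t).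
    by apply: functional_extensionality => -[[]|].
  rewrite psiP; last by case=> [[a|]|] //; case: vt => -[pt _] _; exact: pt.
  rewrite -(@repE X i (fun a => Some (Some a)) B (bind_var q (bind_var p t))) //.
  by rewrite /span_or_trace !flat_cons /flat big_nil addv0.
split=> [[p _ [pp [pon [q _ [pq [qon sW]]]]]]|[p pp [pon [q pq [qon]]]]].
  have Wpq := (E p q pp pq).1 sW; exists p => //; split.
    exact: (@sat_on _ None (Some None) (bind_var p (bind_var x t)) pp).1 pon.
  exists q => //; split=> //.
  exact: (@sat_on _ None (Some (Some None)) (bind_var q (bind_var p (bind_var x t))) pq).1 qon.
rewrite -E // => Wpq; exists p; first by left.
split=> //; split; first exact/sat_on.
by exists q; [left | split=> //; split=> //; apply/sat_on].
Qed.

End Substructure.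

(** * The projective space, the affine space and B1 *)

Lemma based_const (i : kind) (P : Prop) (R : ('I_(len i) -> {vspace V}) -> Prop) :
  (forall t, based i t -> R t <-> P) ->
  exists phi : formula (sig MC) 'I_(len i), forall t, based i t -> sat phi t <-> R t.
Proof.
move=> RP; have [phi phiP] := @definable_const _ _ ptC lnC 'I_(len i) P.
by exists phi => t bt; rewrite RP // phiP //; case: bt.
Qed.

Lemma P_definable : definable_in (structP V) MC.
Proof.
apply: definable_from_C => // i; apply: (@based_const _ True) => t bt.
have := rep_dim bt; rewrite /is_point /is_line => ->.
by case: (lineal i); split=> // _; [right | left].
Qed.

Lemma rep_affine (i : kind) t : based i t -> at_infinity i = false ->
  exists2 u, affine u & u \in rep i t.
Proof.
move=> [pt _] hi; have [u au def_u] := ptA_put (fun _ => @is_b_affine i) pt ord0.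
exists u => //; rewrite /rep hi /= enum_ordSl flat_cons.
by rewrite memvE -def_u addvSl.
Qed.

Lemma rep_in_H (i : kind) t : at_infinity i -> (rep i t <= H)%VS.
Proof. by move=> hi; rewrite /rep hi /= capvSr. Qed.

Lemma in_H_on_H p : is_point p -> (p <= H)%VS -> on_H xi p.
Proof.
move=> pp pH; split=> //; have [u u0 def_p] := point_vector pp.
rewrite def_p /perp orthov11 xi_sq; have : u \in H by rewrite memvE -def_p.
by rewrite in_H => /eqP->; rewrite expr0n.
Qed.

Lemma A_definable : definable_in (structA xi) MC.
Proof.
apply: definable_from_C => // [p []|L []|i] //.
apply: (@based_const _ (at_infinity i = false)) => t bt.
have dr := rep_dim bt; case hi : (at_infinity i); last first.
  have [u au ur] := rep_affine bt hi; split=> // _.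
  case li : (lineal i) dr => dr; [right|left]; split; try by apply/eqP.
    exact: affine_not_contained ur.
  case=> _ /orthovP/(_ u u ur ur)/eqP; by rewrite affine_self ?oner_eq0.
split=> // -[[pr]|[lr]]; case.
  by apply: in_H_on_H => //; apply: rep_in_H.
by move=> p pp pr; apply: in_H_on_H => //; apply: subv_trans pr _; apply: rep_in_H.
Qed.

(** The lines of B1 not in C1 are those through b, if b is on H. *)
Lemma lnB_join u v : affine u -> affine v -> u <> v -> u <> bv ->
  lnB (<[u]> + <[v]>)%VS <->
  ~ vnear u v \/ ~ affine bv /\ bv \in (<[u]> + <[v]>)%VS.
Proof.
move=> au av uv ub; rewrite lnB_line //.
split=> [uv1|[nuv uv1|[nb /add_in_line[a [c def_b]]] uv1]]; last 2 first.
- by apply: nuv; left.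
- have [b0|//] := pole_self.
  have ac : a + c = 0.
    by rewrite -b0 {2}def_b !formE (form_sym xi bv u) (form_sym xi bv v) au av !mulr1.
  have := au; rewrite /affine def_b !formE uv1 affine_self // !mulr1 ac.
  by move/eqP; rewrite eq_sym oner_eq0.
have [nuv|nuv] := classic (vnear u v); last by left.
case: nuv => // -[t def_v]; right.
have t0 : t != 0 by apply/eqP => t0; apply: uv; rewrite def_v t0 scale0r addr0.
split.
  move=> b1; move: av; rewrite /affine def_v !formE au b1 mulr1 => /add_eq_self/eqP.
  by rewrite (negPf t0).
apply/add_in_line; exists (- t^-1), (t^-1); apply: form_ext => z.
by rewrite def_v !formE; field.
Qed.

(** With b on H, lines parallel to a line through b pass through b too, so they
    are no lines of C1.  If the direction d of the given line is not b, a
    point s with xi s d = 1 lies on a parallel that belongs to C1. *)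
Lemma pole_direction u v : ~ affine bv -> affine u -> affine v -> u <> v ->
  bv \in (<[u]> + <[v]>)%VS <->
  forall p, ptC p -> forall q, ptC q -> p <> q ->
    direction_in p q (<[u]> + <[v]>) -> near p q.
Proof.
move=> nb au av uv; have [b0|//] := pole_self.
have nA s : affine s -> s <> bv by move=> a_s sb; apply: nb; move: a_s; rewrite sb.
split=> [/add_in_line[a [c def_b]]|Hpq].
  have ac : a = - c.
    apply/eqP; rewrite -addr_eq0; apply/eqP.
    by rewrite -b0 {2}def_b !formE (form_sym xi bv u) (form_sym xi bv v) au av !mulr1.
  have c0 : c != 0.
    apply/eqP => c0; move: b_point; rewrite /is_point dim_vline def_b ac c0.
    by rewrite oppr0 !scale0r addr0 eqxx.
  move=> _ /ptCP[s [a_s sb ->]] _ /ptCP[s' [as' s'b ->]] _.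
  rewrite direction_inP // => /add_in_line[a' [c' def_d]].
  have ac' : a' = - c'.
    apply/eqP; rewrite -addr_eq0; apply/eqP.
    have := congr1 (xi^~ bv) def_d; rewrite !formE a_s as' au av !mulr1 => <-.
    by rewrite subrr.
  apply/nearP => //; right; exists (c' / c).
  rewrite -[s'](subrK s) addrC def_d def_b ac ac'; congr (_ + _).
  by apply: form_ext => z; rewrite !formE; field.
apply: NNPP => nbL.
have fr : free [:: v - u; bv].
  rewrite free_cons seq1_free span_seq1.
  have -> : bv != 0 by move: b_point; rewrite /is_point dim_vline; case: (bv != 0).
  rewrite andbT.
  apply/vlineP => -[k def_d]; apply: nbL.
  have k0 : k != 0.
    by apply/eqP => k0; apply: uv; apply/esym/eqP; rewrite -subr_eq0 def_d k0 scale0r.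
  apply/add_in_line; exists (- k^-1), k^-1.
  have -> : bv = k^-1 *: (v - u) by rewrite def_d scalerA mulVf // scale1r.
  by rewrite scalerBr scaleNr addrC.
have [s sP] := prescribed_values [:: 1; 1] xi_nd fr.
have /= sd := sP 0%N isT; have /= a_s := sP 1%N isT.
have as' : affine (s + (v - u)) by rewrite /affine !formE a_s au av subrr addr0.
have ss' : s <> s + (v - u).
  move=> h; apply: uv; apply/esym/eqP; rewrite -subr_eq0; apply/eqP.
  by apply: (addrI s); rewrite addr0 -h.
have : near <[s]>%VS <[s + (v - u)]>%VS.
  apply: Hpq.
  - by apply/ptCP; exists s; split=> //; apply: nA.
  - by apply/ptCP; exists (s + (v - u)); split=> //; apply: nA.
  - by move/(affine_line_inj a_s as').
  rewrite direction_inP // [s + _]addrC addrK.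
  by apply/add_in_line; exists (-1), 1; rewrite scale1r scaleN1r addrC.
rewrite nearP //; last exact: nA.
case=> [|[t /addrI def_d]].
  by rewrite formDr affine_self // sd => /add_eq_self/eqP; rewrite oner_eq0.
have := sd; rewrite def_d formZr a_s mulr1 => t1; apply: nbL.
apply/add_in_line; exists (-1), 1.
by rewrite scale1r scaleN1r addrC def_d t1 scale1r.
Qed.

Lemma B_definable : definable_in (point_line_structure ptC lnB) MC.
Proof.
apply: definable_from_C => // [p []|L []|] //.
case=> [[[h l]|] bi]; last first.
  apply: (@based_const _ False) => t bt; split=> //.
  have -> : rep _ t = b.
    rewrite /rep /span_or_trace /= enum_ordSl (size0nil (size_enum_ord 0)).
    by rewrite /flat big_seq1.
  by case=> [[]//|[]]; rewrite /is_line (eqP b_point).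
case: h bi => bi.
  apply: (@based_const _ False) => t bt; split=> //.
  have rH := @rep_in_H _ t isT.
  case=> [/(ptC_ptA)/(not_on_H_P)[pr]|[lr _]]; case.
    exact: in_H_on_H.
  by move=> p pp pr; apply: in_H_on_H => //; apply: subv_trans pr rH.
case: l bi => bi; last first.
  apply: (@based_const _ True) => t [pt _]; split=> // _; left.
  rewrite /rep /span_or_trace /= enum_ordSl (size0nil (size_enum_ord 0)).
  by rewrite /flat big_seq1; apply: pt.
set i : kind := exist _ (Some (false, true)) bi.
pose x : 'I_(len i) := ord0; pose y : 'I_(len i) := lift ord0 ord0.
have xyE (t : 'I_(len i) -> {vspace V}) : rep i t = (t x + t y)%VS.
  rewrite /rep /span_or_trace /= !enum_ordSl (size0nil (size_enum_ord 0)).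
  by rewrite /flat big_cons big_seq1.
have nxy t : based i t -> t x <> t y.
  move=> [_]; rewrite /= !enum_ordSl (size0nil (size_enum_ord 0)) => -[txy _] xy.
  by apply: txy; rewrite /flat big_seq1 /put_b /= -/y -xy.
pose R (e : 'I_(len i) -> {vspace V}) := ~ near (e x) (e y) \/
  ~ affine bv /\ forall p, ptC p -> forall q, ptC q -> p <> q ->
    direction_in p q (e x + e y) -> near p q.
have [phi phiP] : definableC R.
  apply: definable_or; first by apply: definable_not; apply: definable_near.
  apply: definable_and; first exact: definable_const.
  do 2!apply: definable_all; apply: definable_imp.
    by apply: definable_not; apply: definable_eq.
  apply: definable_imp; last exact: definable_near.
  have d := adef_direction_line
    (Some None) None (Some (Some x)) (Some (Some y)).
  by apply: (d (fun=> false)).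
exists phi => t bt; have [pt _] := bt; have := nxy t bt; rewrite phiP // xyE /R.
move: (pt x) (pt y) => /ptCP[u [au ub ->]] /ptCP[v [av vb ->]] xy.
have uv : u <> v by move=> uv; apply: xy; rewrite uv.
rewrite nearP //; have L := lnB_join au av uv ub.
split=> [RR|[[pL]|LB]].
- right; apply/L; case: RR => [|[nb RR]]; [by left | right; split=> //].
  exact/pole_direction.
- by move: pL; rewrite /is_point (eqP (affine_line au av uv)).
- case/L: LB => [|[nb bL]]; [by left | right; split=> //].
  exact/pole_direction.
Qed.

(** * C1 inside B1 *)

Definition nearB p q := p = q \/ ~ joined lnB p q q.

Lemma nearB_P u v : affine u -> affine v -> nearB <[u]>%VS <[v]>%VS <-> xi u v = 1.
Proof.
move=> au av; have [<-|uv] := classic (u = v).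
  by split=> _; [exact: affine_self | left].
have jE : joined lnB <[u]>%VS <[v]>%VS <[v]>%VS <-> xi u v <> 1.
  rewrite -lnB_line //; split=> [[L [lnL uL vL _]]|lnL].
    have lL : is_line L by case: lnL.
    by rewrite -(line_of_two lL au av uv) ?memvE.
  by exists (<[u]> + <[v]>)%VS; rewrite addvSl addvSr.
rewrite /nearB jE; split=> [[/(affine_line_inj au av)//|h]|h]; first exact: NNPP.
by right.
Qed.

(** Let b be on H.  If u and v = u + t bv, then xi x v = xi x u + t, so no x has
    the value 1 at both; if b is not on the line, such an x exists by
    independence of bv, u and v. *)
Lemma lnC_in_B L : lnB L -> lnC L <-> affine bv \/
  exists u v x, [/\ ptC u, ptC v & ptC x] /\
    [/\ (u <= L)%VS, (v <= L)%VS, u <> v, nearB x u & nearB x v].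
Proof.
move=> lnBL; have [u [v [[au av uv] ub vb def_L]]] := lnB_points lnBL.
have uL : u \in L by rewrite def_L memvE addvSl.
have vL : v \in L by rewrite def_L memvE addvSr.
have lnC_affine : affine bv -> lnC L.
  move=> b1; case: (lnBL) => lL rL nH; split=> // bL.
  have nuv : vnear u v.
    by apply: near_of_pole_line => //; rewrite -def_L memvE.
  move: lnBL; rewrite def_L lnB_line //; apply.
  exact/(vnear_pole_affine b1).
split=> [[lL rL nH nb]|[b1|]].
- have [b1|nb1] := classic (affine bv); [by left | right].
  have nA s : affine s -> s <> bv by move=> a_s sb; apply: nb1; move: a_s; rewrite sb.
  have fr : free [:: bv; u; v].
    by apply: (free_pole au av uv); rewrite -def_L memvE; apply/negP.
  have [x xP] := prescribed_values [:: 1; 1; 1] xi_nd fr.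
  have /= ax := xP 0%N isT; have /= xu := xP 1%N isT; have /= xv := xP 2%N isT.
  exists <[u]>%VS, <[v]>%VS, <[x]>%VS; rewrite -!memvE; split.
    by split; apply/ptCP; [exists u | exists v | exists x; split=> //; apply: nA].
  by split=> //; [move/(affine_line_inj au av) | apply/nearB_P | apply/nearB_P].
- exact: lnC_affine.
case=> p [q [r [[/ptCP[s [a_s sb ->]] /ptCP[s' [as' s'b ->]]]]]].
move=> /ptCP[x [ax xb ->]] [sL s'L ss']; rewrite !nearB_P // => xs xs'.
have ss : s <> s' by move=> ss; apply: ss'; rewrite ss.
have [b0|] := pole_self; last exact: lnC_affine.
case: (lnBL) => lL rL nH; split=> //; rewrite -!memvE in sL s'L *.
rewrite (line_of_two lL a_s as' ss sL s'L) => /add_in_line[a [c def_b]].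
have ac : a + c = 1.
  by move: ax; rewrite /affine def_b !formE xs xs' !mulr1.
move/eqP: ac; rewrite eq_sym.
have -> : a + c = 0.
  by rewrite -b0 {2}def_b !formE (form_sym xi bv s) (form_sym xi bv s') a_s as' !mulr1.
by rewrite oner_eq0.
Qed.

Lemma C_definable : definable_in (point_line_structure ptC lnC) MB.
Proof.
have lnCB L : lnC L -> lnB L by case.
have [near_phi near_phiP] : definable ptC lnB (fun e : bool -> _ => nearB (e true) (e false)).
  apply: definable_or; first exact: definable_eq.
  by apply: definable_not; apply: definable_joined.
pose FNear X (x y : X) : formula (sig MB) X := rename near_phi (fun i : bool => if i then x else y).
have FNearP X (x y : X) e : ptC (e x) -> ptC (e y) ->
    sat (FNear X x y) e <-> nearB (e x) (e y).
  by move=> px py; rewrite sat_rename near_phiP //; case.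
have [b1|nb1] := classic (affine bv).
  apply: (@substructure_definable _ _ _ _ _ _ _ _ _ _ (FOr (FPoint ptC lnB ord0)
    (@FRel (sig MB) _ SLine (fun=> ord0)))) => // [p []|MC []|t Mt] //=.
  split=> -[pt|lt]; [by left | right | by left | right; exact: lnCB].
  by rewrite (lnC_in_B lt); left.
pose phi : formula (sig MB) 'I_1 := FOr (FPoint ptC lnB ord0)
  (FEx (FEx (FEx (FAnd (FAnd (FPoint ptC lnB (Some (Some None)))
      (FAnd (FPoint ptC lnB (Some None)) (FPoint ptC lnB None)))
    (FAnd (FAnd (FIn ptC lnB (Some (Some None)) (Some (Some (Some ord0))))
      (FIn ptC lnB (Some None) (Some (Some (Some ord0)))))
    (FAnd (FNot (FEq _ (Some (Some None)) (Some None)))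
    (FAnd (FNear _ None (Some (Some None))) (FNear _ None (Some None))))))))).
apply: (@substructure_definable _ _ _ _ _ _ _ _ _ _ phi) => // [p []|MC []|t Mt] //.
split=> [[pt|[u _ [v _ [x _ [[pu [pv px]] [[uL vL] [uv [xu xv]]]]]]]]|].
- by left.
- have [_ lt uL'] := uL; have [_ _ vL'] := vL; right.
  apply/(lnC_in_B lt); right; exists u, v, x; split=> //.
  split=> //; first exact: (FNearP _ None (Some (Some None)) _ _ _).1 xu.
  exact: (FNearP _ None (Some None) _ _ _).1 xv.
case=> [pt|lC]; [by left | have lt := lnCB _ lC; right].
have [//|[u [v [x [[pu pv px] [uL vL uv xu xv]]]]]] :=
  (lnC_in_B lt).1 lC.
exists u; first by left.
exists v; first by left.
exists x; first by left.
split=> //; split=> //; split=> //; split; exact/FNearP.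
Qed.

End Geometry.

Theorem theorem3p20 (F : fieldType) (V : vectType F) (xi : {symmetric V})
    (b : {vspace V})
    (charF : 2%N \in [pchar F])
    (perfF : perfect_field F)
    (dimV : (2 <= \dim {:V})%N)
    (lines6 : lines_have_at_least V 6)
    (xi_nondeg : nondegenerate xi)
    (xi_nonalt : ~ alternating xi)
    (b_pole : pole_of_H xi b) :
  [/\ definable_in (structB1 xi b) (structC1 xi b),
      definable_in (structC1 xi b) (structB1 xi b),
      definable_in (structA xi) (structC1 xi b)
    & definable_in (structP V) (structC1 xi b)].
Proof.
have [bv [def_b xi_sq]] := pole_vector charF perfF xi_nonalt b_pole.
have outside s := @scalar_outside _ _ s lines6 dimV.
have b_point : is_point <[bv]>%VS by rewrite -def_b; case: b_pole.
rewrite def_b; split.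
- exact: B_definable.
- exact: C_definable.
- exact: A_definable.
- exact: P_definable.
Qed.
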